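(* Let $n \geq 1$ be an integer. Let $F$ be the set of $X$-formable matrices of size $n$ over $\mathbb{C}$ and $G$ the set of $X$-formable matrices of size $n$ over $\mathbb{R}$. Then: (i) $F$ is dense in $M_{n}(\mathbb{C})$. (ii) The interior of $F$ in $M_n(\mathbb{C})$ is $\{A \in M_{n}(\mathbb{C}) : \chi_{A} \text{ verifies } (\mathcal{P}) \text{ over } \mathbb{C}\}=\{A \in M_{n}(\mathbb{C}) : \chi_{A} \text{ has only simple or double roots}\}$. (iii) $G$ is dense in $M_{n}(\mathbb{R})$. (iv) The interior of $G$ in $M_n(\mathbb{R})$ is $\{A \in M_{n}(\mathbb{R}) : \chi_{A} \text{ verifies } (\mathcal{P}) \text{ over } \mathbb{R}\}$.
   Context: $M_n(\mathbb{K})$, for $\mathbb{K}=\mathbb{R}$ or $\mathbb{C}$, is the space of $n\times n$ matrices over $\mathbb{K}$ with its usual topology as a finite-dimensional normed space (e.g. the norm $\|A\|_\infty=\max_{i,j}|a_{i,j}|$). $\chi_A(X)=\det(XI_n-A)$ is the (monic) characteristic polynomial. An $X$-form matrix is a square matrix for which only the diagonal and the anti-diagonal elements can be different from zero (i.e. the $(i,j)$ entry is zero unless $i=j$ or $i+j=n+1$). A matrix of size $n$ over $\mathbb{K}$ is $X$-formable over $\mathbb{K}$ if it is similar over $\mathbb{K}$ to an $X$-form matrix with entries in $\mathbb{K}$. A monic polynomial over $\mathbb{K}$ verifies $(\mathcal{P})$ over $\mathbb{K}$ if it can be written as $\prod_{i=1}^{r} P_{i}(X) \prod_{i=1}^{q}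 (X-\lambda_{i})^{n_{i}}$ with $r,q\ge 0$, $P_i\in\mathbb{K}[X]$ irreducible (over $\mathbb{K}$) monic polynomials of degree $2$, $\lambda_i\in\mathbb{K}$, $1\le n_i\le 2$, and $P_i\ne P_j$, $\lambda_i\neq\lambda_j$ for $i\ne j$ (empty products equal $1$). *)

(* Defs.v *)
From HB Require Import structures.
From mathcomp Require Import all_boot all_order all_algebra.
From mathcomp Require Import complex.
From mathcomp Require Import boolp classical_sets reals topology normedtype.

Set Implicit Arguments.
Unset Strict Implicit.
Unset Printing Implicit Defensive.

Import Order.TTheory GRing.Theory Num.Theory.
Import numFieldNormedType.Exports.

Local Open Scope classical_set_scope.
Local Open Scope ring_scope.

(* The topology of the modulus on R[i]: the one MathComp-Analysis gives to any
   numFieldType, which is not inferred for the concrete type R[i]. *)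
HB.instance Definition _ (R : rcfType) := PseudoPointedMetric.copy R[i] (R[i])^o.

(* Ordinals count from 0, so the 1-based condition i + j = n + 1 defining the
   anti-diagonal reads (i + j).+1 = n. *)
Definition is_xform_mx (K : fieldType) (n : nat) (A : 'M[K]_n) : bool :=
  [forall i : 'I_n, forall j : 'I_n,
    (i != j) && ((i + j).+1 != n)%N ==> (A i j == 0)].

Definition xformable (K : fieldType) (n : nat) (A : 'M[K]_n) : Prop :=
  similar_in_to unitmx A (@is_xform_mx K n).

Definition verifiesP (K : fieldType) (p : {poly K}) : Prop :=
  exists (r q : nat) (P : 'I_r -> {poly K}) (lam : 'I_q -> K) (m : 'I_q -> nat),
    [/\ forall i, [/\ irreducible_poly (P i), P i \is monic & size (P i) = 3%N],
        injective P,
        injective lam,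
        forall i, (1 <= m i <= 2)%N &
        p = (\prod_(i < r) P i) * \prod_(i < q) ('X - (lam i)%:P) ^+ m i].

Definition simple_or_double_roots (K : fieldType) (p : {poly K}) : Prop :=
  forall x : K, root p x -> mup x p = 1%N \/ mup x p = 2%N.

(* Main.v *)
Require Import Defs.
From HB Require Import structures.
From mathcomp Require Import all_boot all_order all_algebra.
From mathcomp Require Import complex.
From mathcomp Require Import boolp classical_sets reals topology normedtype.
From mathcomp Require Import perm separable ring.

Set Implicit Arguments.
Unset Strict Implicit.
Unset Printing Implicit Defensive.

Import Order.TTheory GRing.Theory Num.Theory.
Import numFieldNormedType.Exports.

Local Open Scope classical_set_scope.
Local Open Scope ring_scope.

(** For any field, (P) says that every power of an irreducible polynomial dividing
    p has degree at most 2 ([small_mult]).  If the characteristic polynomial of A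
    has this property, it splits into pairwise coprime factors of degree 2 (and
    possibly one of degree 1), so A is similar to a block diagonal matrix with
    2x2 blocks, that is, to an X-form matrix.  Conversely, by Cayley-Hamilton on
    the 2x2 blocks, an X-formable matrix satisfies ker pi^m(A) = ker pi^(m-1)(A)
    whenever pi is irreducible and deg pi^m > 2.  If such a pi^m divides the
    characteristic polynomial of A, then arbitrarily small perturbations of A
    (keeping the characteristic polynomial) break this equality, so A is not
    interior.  The converse inclusion is the openness of (P), a consequence of the
    continuity of the complex roots counted with multiplicity; density holds since
    matrices with separable characteristic polynomial are dense. *)

(** The characteristic polynomial alone does not obstruct X-formability: scalar matrices of every
    size are X-form. What a perturbation can create is a row vector of order exactly pi^m in the
    K[X]-module of the matrix. Arguing on orders of vectors instead of Jordan forms treats linear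
    and quadratic pi, hence both fields, at once. Such a vector is built one factor pi at a time: in
    a block triangular form with a diagonal block [C] killed by pi and a remaining block [A2], an
    approximation of [A2] supplies a vector of order pi^(m-1), and moving the off-diagonal block,
    which leaves the characteristic polynomial unchanged, raises that order to pi^m. The second
    perturbation depends on the first, so the argument is a closure inside a closure. The delicate
    point of openness over the reals is a double nonreal root of a nearby matrix: it could only come
    from a double real root y, and its conjugate, also double, would put four roots around y. *)

(** * Powers of irreducible factors and coprime splittings *)

Section SmallMult.

Variable K : fieldType.
Implicit Types (p q pi : {poly K}) (m : nat).

Lemma irredp_dvd_coprime pi p :
  irreducible_poly pi -> ~~ (pi %| p) -> coprimep pi p.
Proof.
case=> pi_gt1 pi_irr pi'p; apply/coprimepP => d d_pi d_p.
rewrite -size_poly_eq1; case: eqP => // /eqP /pi_irr /(_ d_pi) d_eq_pi.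
by rewrite (eqp_dvdl _ d_eq_pi) in d_p; rewrite d_p in pi'p.
Qed.

Lemma irredp_dvdM pi p q : irreducible_poly pi ->
  pi %| p * q -> (pi %| p) || (pi %| q).
Proof.
move=> pi_irr; case: (boolP (pi %| p)) => //= pi'p.
by rewrite Gauss_dvdpr // irredp_dvd_coprime.
Qed.

Lemma irredp_dvdX pi p m : irreducible_poly pi -> pi %| p ^+ m -> pi %| p.
Proof.
move=> pi_irr; elim: m => [|m IHm].
  rewrite expr0 dvdp1 => /eqP pi1; have := pi_irr.1; by rewrite pi1.
by rewrite exprS => /(irredp_dvdM pi_irr)/orP[|/IHm].
Qed.

Lemma irredp_size_eqp pi p : irreducible_poly pi -> (1 < size p)%N ->
  p %| pi -> pi %= p.
Proof.
move=> pi_irr p_gt1 p_pi; rewrite eqp_sym; apply: pi_irr p_pi.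
by rewrite neq_ltn p_gt1 orbT.
Qed.

Lemma irredp_eqp_dvd pi p : irreducible_poly pi -> irreducible_poly p ->
  pi %| p -> pi %= p.
Proof.
move=> pi_irr p_irr pi_p; apply: p_irr pi_p.
by rewrite neq_ltn pi_irr.1 orbT.
Qed.

Lemma monic_irredp_dvd p : (1 < size p)%N ->
  exists pi, [/\ irreducible_poly pi, pi \is monic & pi %| p].
Proof.
have [k le_pk] := ubnP (size p); elim: k => // k IHk in p le_pk *.
move=> p_gt1; have p_neq0 : p != 0 by rewrite -size_poly_gt0 ltnW.
have [p_irr | /asboolPn p_red] := pselect (irreducible_poly p).
  exists ((lead_coef p)^-1 *: p).
  have sc : (lead_coef p)^-1 != 0 by rewrite invr_eq0 lead_coef_eq0.
  have eqp_s : (lead_coef p)^-1 *: p %= p by rewrite eqp_scale.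
  split; last by rewrite (eqp_dvdl _ eqp_s).
    split; first by rewrite size_scale.
    move=> q q_neq1; rewrite (eqp_dvdr _ eqp_s) => /(p_irr.2 _ q_neq1) qp.
    by rewrite (eqp_trans qp) // eqp_sym.
  by rewrite monicE lead_coefZ mulVf // lead_coef_eq0.
have [q [q_neq1 q_p q_neqp]] : exists q, [/\ size q != 1, q %| p & ~~ (q %= p)].
  move/asboolP : p_red => p_red; apply: contrapT => noq; apply: p_red.
  split=> // q q_neq1 q_p; apply: contrapT => /negP q_neqp.
  by apply: noq; exists q.
have q_neq0 : q != 0 by apply: contraTneq q_p => ->; rewrite dvd0p.
have q_gt1 : (1 < size q)%N.
  by rewrite ltn_neqAle eq_sym q_neq1 size_poly_gt0.
have lt_qp : (size q < size p)%N.
  by rewrite ltn_neqAle dvdp_leq // andbT -(dvdp_size_eqp q_p) in q_neqp *.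
have [|pi [pi_irr pi_monic pi_q]] := IHk q _ q_gt1.
  by rewrite (leq_trans lt_qp).
by exists pi; split=> //; apply: dvdp_trans pi_q q_p.
Qed.

(** If [pi] did not divide the cofactor of [g], the whole power would divide [g] by Gauss, against
    the size; so one [pi] cancels from the cofactor. *)
Lemma dvdp_irredX pi g m : irreducible_poly pi ->
  g %| pi ^+ m.+1 -> (size g < size (pi ^+ m.+1))%N -> g %| pi ^+ m.
Proof.
move=> pi_irr /dvdpP[h pigh] lt_g.
have pi_neq0 := irredp_neq0 pi_irr.
have : pi %| h.
  apply: contraLR lt_g => pi'h; rewrite -leqNgt; apply: dvdp_leq.
    apply: contra_neq (expf_neq0 m.+1 pi_neq0) => g0.
    by rewrite pigh g0 mulr0.
  rewrite -(@Gauss_dvdpr _ _ h) -?pigh //.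
  by rewrite coprimep_expl // irredp_dvd_coprime.
case/dvdpP=> h' def_h; apply/dvdpP; exists h'.
by apply: (mulIf pi_neq0); rewrite -exprSr pigh def_h mulrAC.
Qed.

(* The field-independent content of (P). *)
Definition small_mult p :=
  forall pi m, irreducible_poly pi -> pi ^+ m %| p -> (size (pi ^+ m) <= 3)%N.

Lemma small_mult_dvd p q : q %| p -> small_mult p -> small_mult q.
Proof. by move=> q_p sm_p pi m pi_irr /dvdp_trans/(_ q_p); apply: sm_p. Qed.

Lemma irredp_max_exp pi p : irreducible_poly pi -> p != 0 ->
  exists m q, p = pi ^+ m * q /\ ~~ (pi %| q).
Proof.
move=> pi_irr; have [k le_pk] := ubnP (size p); elim: k => // k IHk in p le_pk *.
move=> p_neq0; have [/dvdpP[q def_p] | ndvd] := boolP (pi %| p); last first.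
  by exists 0, p; rewrite mul1r.
have /norP[q_neq0 pi_neq0] : ~~ ((q == 0) || (pi == 0)).
  by rewrite -mulf_eq0 -def_p.
have [||m [r [def_q ndvd]]] := IHk q => //.
  rewrite (leq_trans _ (le_pk : (size p <= k)%N)) // def_p size_mul //.
  by case: (size pi) pi_irr.1 => [|[|s]] // _; rewrite !addnS ltnS leq_addr.
by exists m.+1, r; rewrite def_p {1}def_q mulrC mulrA exprS.
Qed.

Lemma size_polyX_le3 pi m : irreducible_poly pi -> (size (pi ^+ m) <= 3)%N ->
  [\/ m = 0, m = 1 /\ size pi = 2,  m = 1 /\ size pi = 3 |
      m = 2 /\ size pi = 2].
Proof.
move=> [pi_gt1 _]; have: (size (pi ^+ m)).-1 = ((size pi).-1 * m)%N.
  by rewrite size_exp.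
case: m => [|m]; first by constructor 1.
case: (size pi) pi_gt1 => [|[|s]] //= _ def_m le3.
have : (s.+1 * m.+1 <= 2)%N by rewrite -def_m; case: (size _) le3.
case: s m {def_m le3} => [|[|s]] [|[|m]] //.
- by move=> _; constructor 2.
- by move=> _; constructor 4.
- by move=> _; constructor 3.
Qed.

Lemma irredp_size2 pi : size pi = 2%N -> pi \is monic ->
  exists lam, pi = 'X - lam%:P.
Proof.
move=> pi2 /monicP lc; exists (- pi`_0); apply/polyP => -[|[|i]].
- by rewrite !coefE sub0r opprK.
- by rewrite !coefE /= subr0 -lc lead_coefE pi2.
- by rewrite nth_default ?pi2 // !coefE subr0.
Qed.

(** Either some full primary component [pi ^+ m] already has degree 2, or every irreducible factor
    is linear and simple and two distinct ones are multiplied. In both cases only full primary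
    components are taken, whence coprimality with the rest. *)
Lemma small_mult_split p : p \is monic -> small_mult p -> (2 < size p)%N ->
  exists p1 p2, [/\ p = p1 * p2, p1 \is monic, p2 \is monic,
                    coprimep p1 p2 & size p1 = 3%N].
Proof.
move=> p_monic sm_p p_gt2; have p_neq0 := monic_neq0 p_monic.
have conc p1 q : p1 \is monic -> p = p1 * q -> coprimep p1 q -> size p1 = 3%N ->
    exists p1 p2, [/\ p = p1 * p2, p1 \is monic, p2 \is monic,
                    coprimep p1 p2 & size p1 = 3%N].
  move=> p1m def_p cop sz; exists p1, q; split=> //.
  by rewrite -(monicMl _ p1m) -def_p.
have [[pi [m [q [pi_irr pi_m def_p pi'q]]]] | no3] := pselect (exists pi m q,
  [/\ irreducible_poly pi, pi \is monic, p = pi ^+ m * q /\ size (pi ^+ m) = 3%N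
     & ~~ (pi %| q)]).
  case: def_p => def_p sz; apply: (conc (pi ^+ m) q) => //.
    exact: monic_exp.
  by rewrite coprimep_expl // irredp_dvd_coprime.
have lin pi : irreducible_poly pi -> pi \is monic -> pi %| p ->
    exists q, [/\ p = pi * q, ~~ (pi %| q) & size pi = 2%N].
  move=> pi_irr pi_m pi_p.
  have [m [r [def_p pi'r]]] := irredp_max_exp pi_irr p_neq0.
  have le3 : (size (pi ^+ m) <= 3)%N.
    by apply: sm_p => //; rewrite def_p dvdp_mulr.
  case: (size_polyX_le3 pi_irr le3) => [m0|[m1 s2]|[m1 s3]|[m2 s2]].
  - by move: pi_p pi'r; rewrite def_p m0 mul1r => ->.
  - by exists r; split=> //; rewrite def_p m1.
  - by case: no3; exists pi, m, r; split=> //; rewrite m1 in def_p *.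
  - case: no3; exists pi, m, r; split=> //; rewrite m2 in def_p *.
    split=> //; case: (size (pi ^+ 2)) (size_exp pi 2) => [|s] /=.
      by rewrite s2.
    by rewrite s2 => ->.
have [|pi [pi_irr pi_m pi_p]] := @monic_irredp_dvd p; first exact: ltnW.
have [q [def_p pi'q sz_pi]] := lin pi pi_irr pi_m pi_p.
have sz_q : (1 < size q)%N.
  have q_neq0 : q != 0 by apply: contraNneq pi'q => ->; rewrite dvdp0.
  by move: p_gt2; rewrite def_p size_mul ?(monic_neq0 pi_m) // sz_pi add2n /=.
have [pi2 [pi2_irr pi2_m pi2_q]] := monic_irredp_dvd sz_q.
have [|q2 [def_p2 pi2'q sz_pi2]] := lin pi2 pi2_irr pi2_m.
  by rewrite def_p dvdp_mull.
have /dvdpP[r def_q] := pi2_q.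
have pi'r : ~~ (pi %| r).
  by apply: contra pi'q; rewrite def_q => /dvdp_mulr ->.
have pi2'r : ~~ (pi2 %| r).
  apply: contra pi2'q => /dvdpP[s def_r]; apply/dvdpP; exists (pi * s).
  apply: (mulIf (irredp_neq0 pi2_irr)); rewrite mulrC -def_p2 def_p def_q def_r.
  by rewrite !mulrA.
apply: (conc (pi * pi2) r).
- by rewrite monicMl.
- by rewrite def_p def_q mulrA mulrAC.
- by rewrite coprimepMl !irredp_dvd_coprime.
- by rewrite size_mul ?irredp_neq0 // sz_pi sz_pi2.
Qed.

End SmallMult.

(** * Equivalence of (P) with [small_mult] for monic polynomials *)

Section VerifiesP.

Variable K : fieldType.
Implicit Types (p q pi : {poly K}) (m : nat).

Lemma small_multM p q :
  coprimep p q -> small_mult p -> small_mult q -> small_mult (p * q).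
Proof.
move=> cop_pq sm_p sm_q pi m pi_irr pim.
have [pi_p | pi'p] := boolP (pi %| p).
  apply: sm_p => //; move: pim; rewrite Gauss_dvdpl // coprimep_expl //.
  by apply: coprimep_dvdr cop_pq; rewrite // coprimep_sym.
apply: sm_q => //; move: pim; rewrite Gauss_dvdpr // coprimep_expl //.
exact: irredp_dvd_coprime.
Qed.

Lemma small_mult_prod (I : eqType) (s : seq I) (f : I -> {poly K}) :
    uniq s -> (forall i, small_mult (f i)) ->
    (forall i j, i != j -> coprimep (f i) (f j)) ->
  small_mult (\prod_(i <- s) f i).
Proof.
move=> uniq_s sm_f cop_f; elim: s uniq_s => [_|i s IHs /andP[s'i uniq_s]].
  rewrite big_nil => pi m _ /dvdp_leq; rewrite oner_neq0 size_poly1.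
  by move=> /(_ isT)/leq_trans; apply.
rewrite big_cons; apply: small_multM (sm_f i) (IHs uniq_s).
elim: s s'i {IHs uniq_s} => [_|j s IHs]; first by rewrite big_nil coprimep1.
rewrite inE negb_or big_cons coprimepMr => /andP[neq_ij /IHs ->].
by rewrite cop_f.
Qed.

Lemma coprimep_irred3_XsubC pi lam : irreducible_poly pi -> size pi = 3%N ->
  coprimep pi ('X - lam%:P).
Proof.
move=> pi_irr pi3; apply: irredp_dvd_coprime => //; apply/negP => /dvdp_leq.
by rewrite polyXsubC_eq0 size_XsubC pi3 => /(_ isT).
Qed.

Lemma verifiesP_small_mult p : verifiesP p -> small_mult p.
Proof.
case=> r [q [P [lam [m [P_spec P_inj lam_inj m_le2 ->]]]]].
(* Both families of factors are merged over a sum type, so that pairwise coprimality becomes a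
   single statement. *)
pose f (i : 'I_r + 'I_q) :=
  match i with inl i => P i | inr i => ('X - (lam i)%:P) ^+ m i end.
have -> : (\prod_(i < r) P i) * \prod_(i < q) ('X - (lam i)%:P) ^+ m i
          = \prod_(i <- index_enum ('I_r + 'I_q)%type) f i.
  by rewrite big_sumType.
have Plam i j : coprimep (P i) ('X - (lam j)%:P).
  by have [? _ ?] := P_spec i; apply: coprimep_irred3_XsubC.
apply: small_mult_prod => [|[i|i] pi k pi_irr pik|].
- exact: index_enum_uniq.
- have [P_irr _ Psz] := P_spec i; rewrite -Psz.
  by apply: dvdp_leq pik; apply: irredp_neq0.
- apply: leq_trans (dvdp_leq _ pik) _; first by rewrite expf_neq0 ?polyXsubC_eq0.
  by rewrite size_exp_XsubC ltnS; have /andP[] := m_le2 i.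
case=> [i|i] [j|j] neq_ij //=.
- have [Pi_irr Pi_m _] := P_spec i; have [Pj_irr Pj_m _] := P_spec j.
  apply: irredp_dvd_coprime => //; apply: contra neq_ij => dv.
  have := irredp_eqp_dvd Pi_irr Pj_irr dv.
  by rewrite eqp_monic // => /eqP/P_inj ->.
- by rewrite coprimep_expr.
- by rewrite coprimep_sym coprimep_expr.
- rewrite coprimep_expl ?coprimep_expr // coprimep_XsubC2 // subr_eq0.
  by apply: contra neq_ij => /eqP/lam_inj->.
Qed.

Definition ord_cons (T : Type) n (x : T) (f : 'I_n -> T) (i : 'I_n.+1) :=
  if unlift ord0 i is Some j then f j else x.

Lemma ord_cons_inj (T : Type) n (x : T) (f : 'I_n -> T) :
  injective f -> (forall i, f i <> x) -> injective (ord_cons x f).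
Proof.
move=> f_inj f'x i j; rewrite /ord_cons.
by case: unliftP => [i'|] ->; case: unliftP => [j'|] -> //;
  [move/f_inj-> | move/f'x | move/esym/f'x].
Qed.

Lemma verifiesP_cons_irred pi p : irreducible_poly pi -> pi \is monic ->
  size pi = 3%N -> ~~ (pi %| p) -> verifiesP p -> verifiesP (pi * p).
Proof.
move=> pi_irr pi_m pi3 pi'p [r [q [P [lam [m [P_spec P_inj lam_inj m_le2 def_p]]]]]].
exists r.+1, q, (ord_cons pi P), lam, m; split=> //.
- by move=> i; rewrite /ord_cons; case: unliftP.
- apply: ord_cons_inj => // i Ppi; case/negP: pi'p.
  by rewrite def_p (bigD1 i) //= Ppi -mulrA dvdp_mulr.
- rewrite def_p mulrA big_ord_recl {1}/ord_cons unlift_none; congr (_ * _ * _).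
  by apply: eq_bigr => i _; rewrite /ord_cons liftK.
Qed.

Lemma verifiesP_cons_lin a k p : (1 <= k <= 2)%N ->
  ~~ root p a -> verifiesP p -> verifiesP (('X - a%:P) ^+ k * p).
Proof.
move=> k_le2 p'a [r [q [P [lam [m [P_spec P_inj lam_inj m_le2 def_p]]]]]].
exists r, q.+1, P, (ord_cons a lam), (ord_cons k m); split=> //.
- apply: ord_cons_inj => // i lama; case/negP: p'a.
  rewrite def_p rootM (bigD1 i) //= rootM lama.
  by case: (m i) (m_le2 i) => // s _; rewrite root_exp_XsubC eqxx orbT.
- by move=> i; rewrite /ord_cons; case: unliftP.
- rewrite def_p mulrCA big_ord_recl {1 2}/ord_cons unlift_none.
  congr (_ * (_ * _)).
  by apply: eq_bigr => i _; rewrite /ord_cons liftK.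
Qed.

(** Induction on the size, removing a full primary component [pi ^+ m] each time: [pi] no longer
    divides the cofactor, which keeps the [P i] and the [lam i] distinct. *)
Lemma small_mult_verifiesP p : p \is monic -> small_mult p -> verifiesP p.
Proof.
have [k le_pk] := ubnP (size p); elim: k => // k IHk in p le_pk *.
move=> p_m sm_p; have p_neq0 := monic_neq0 p_m.
have [p_le1 | p_gt1] := leqP (size p) 1.
  exists 0%N, 0%N, (fun=> 0), (fun=> 0), (fun=> 0%N); split.
  - by case.
  - by case.
  - by case.
  - by case.
  - rewrite !big_ord0 mulr1; have := p_m.
    by rewrite (size1_polyC p_le1) monicE lead_coefC => /eqP->.
have [pi [pi_irr pi_m pi_p]] := monic_irredp_dvd p_gt1.
have [m [q [def_p pi'q]]] := irredp_max_exp pi_irr p_neq0.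
have m_gt0 : (0 < m)%N.
  by case: m def_p pi_p => // ->; rewrite mul1r (negPf pi'q).
have q_m : q \is monic by rewrite -(monicMl q (monic_exp m pi_m)) -def_p.
have vq : verifiesP q.
  apply: IHk => //; last by apply: small_mult_dvd sm_p; rewrite def_p dvdp_mull.
  rewrite (leq_trans _ (le_pk : (size p <= k)%N)) // def_p.
  rewrite size_mul ?expf_neq0 ?(irredp_neq0 pi_irr) ?(monic_neq0 q_m) //.
  have : (1 < size (pi ^+ m))%N.
    have := size_exp pi m; case: (size (pi ^+ m)) => [|[|s]] //=;
    by case: (size pi) pi_irr.1 => [|[|?]] // _; case: m m_gt0 {def_p}.
  by case: (size (pi ^+ m)) => [|[|s]] // _; rewrite !addSn /= ltnS leq_addl.
have le3 : (size (pi ^+ m) <= 3)%N by apply: sm_p => //; rewrite def_p dvdp_mulr.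
rewrite def_p.
have lin : size pi = 2%N -> (1 <= m <= 2)%N -> verifiesP (pi ^+ m * q).
  move=> s2 m_le2; have [a def_pi] := irredp_size2 s2 pi_m.
  move: pi'q; rewrite def_pi dvdp_XsubCl => q'a; exact: verifiesP_cons_lin.
case: (size_polyX_le3 pi_irr le3) => [m0|[m1 s2]|[m1 s3]|[m2 s2]].
- by rewrite m0 in m_gt0.
- by apply: lin; rewrite ?m1.
- by rewrite m1; apply: verifiesP_cons_irred.
- by apply: lin; rewrite ?m2.
Qed.

End VerifiesP.

(** * Polynomials in a matrix, and similarity across sizes *)

Section EvalMx.

Variable K : fieldType.
Implicit Types (p q pi : {poly K}).

(* horner_mx without the restriction to nonzero sizes *)
Definition evalmx n : 'M[K]_n -> {poly K} -> 'M[K]_n :=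
  match n with 0 => fun _ _ => 0 | _.+1 => fun A p => horner_mx A p end.

Lemma evalmxE n (A : 'M[K]_n) p :
  evalmx A p = \sum_(i < size p) p`_i *: A ^+ i.
Proof.
case: n A => [|n] A; first by apply/matrixP => - [].
rewrite /= -[p in LHS]coefK poly_def rmorph_sum; apply: eq_bigr => i _.
by rewrite /= linearZ /= rmorphXn /= horner_mx_X.
Qed.

Lemma evalmxM n (A : 'M[K]_n) p q : evalmx A (p * q) = evalmx A p *m evalmx A q.
Proof.
by case: n A => [|n] A /=; [apply/matrixP => - [] | rewrite rmorphM].
Qed.

Lemma evalmxD n (A : 'M[K]_n) p q : evalmx A (p + q) = evalmx A p + evalmx A q.
Proof.
by case: n A => [|n] A /=; [apply/matrixP => - [] | rewrite rmorphD].
Qed.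

Lemma evalmxC n (A : 'M[K]_n) c : evalmx A c%:P = c%:M.
Proof.
by case: n A => [|n] A /=; [apply/matrixP => - [] | rewrite horner_mx_C].
Qed.

Lemma evalmx1 n (A : 'M[K]_n) : evalmx A 1 = 1%:M.
Proof. exact: evalmxC. Qed.

Lemma evalmx0 n (A : 'M[K]_n) : evalmx A 0 = 0.
Proof. by rewrite evalmxE size_poly0 big_ord0. Qed.

Lemma evalmxX n (A : 'M[K]_n) : evalmx A 'X = A.
Proof.
by case: n A => [|n] A /=; [apply/matrixP => - [] | rewrite horner_mx_X].
Qed.

Lemma evalmxXn n (A : 'M[K]_n) k : evalmx A ('X^k) = A ^+ k.
Proof.
elim: k => [|k IHk]; first exact: evalmx1.
by rewrite !exprS evalmxM IHk evalmxX.
Qed.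

Lemma evalmx_comm n (A : 'M[K]_n) p q :
  evalmx A p *m evalmx A q = evalmx A q *m evalmx A p.
Proof. by rewrite -!evalmxM mulrC. Qed.

(** A rectangular [T] covers at once the inclusion of a stable subspace, the projection onto a
    quotient block and a change of basis. *)
Lemma evalmx_intertwine m n (A : 'M[K]_m) (B : 'M[K]_n) (T : 'M[K]_(m, n)) p :
  A *m T = T *m B -> evalmx A p *m T = T *m evalmx B p.
Proof.
move=> AT; elim/poly_ind: p => [|p c IHp]; first by rewrite !evalmx0 mul0mx mulmx0.
rewrite !evalmxD !evalmxM !evalmxX !evalmxC mulmxDl mulmxDr -mulmxA AT mulmxA IHp.
by rewrite mulmxA scalar_mxC.
Qed.

Lemma evalmx_char_poly n (A : 'M[K]_n) : evalmx A (char_poly A) = 0.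
Proof.
by case: n A => [|n] A /=; [apply/matrixP => - [] | exact: Cayley_Hamilton].
Qed.

(* q(X) I - q(A) is a multiple of X I - A; take determinants. *)
Lemma char_poly_dvdX n (A : 'M[K]_n) q : evalmx A q = 0 -> char_poly A %| q ^+ n.
Proof.
move=> qA0; pose x : 'M[{poly K}]_n := 'X%:M; pose a := map_mx (@polyC K) A.
have xa_comm : GRing.comm x a by rewrite /GRing.comm -!mulmxE scalar_mxC.
have qx : q%:M = \sum_(i < size q) (q`_i)%:P *: x ^+ i.
  rewrite -[q in LHS]coefK poly_def raddf_sum; apply: eq_bigr => i _ /=.
  rewrite -mul_polyC scalar_mxM mul_scalar_mx; congr (_ *: _).
  elim: {i}(val i) => [|i IHi]; first by rewrite !expr0.
  by rewrite !exprS scalar_mxM IHi.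
have qa : \sum_(i < size q) (q`_i)%:P *: a ^+ i = 0.
  transitivity (map_mx (@polyC K) (evalmx A q)); last by rewrite qA0 map_mx0.
  rewrite evalmxE raddf_sum; apply: eq_bigr => i _ /=.
  rewrite map_mxZ; congr (_ *: _).
  elim: {i}(val i) => [|i IHi]; first by rewrite !expr0; apply/esym; exact: map_mx1.
  by rewrite !exprS IHi -!mulmxE map_mxM.
(* Since [x] and [a] commute, each [x ^+ i - a ^+ i] is a multiple of [x - a], which is
   [char_poly_mx A]. *)
have [S qS] : exists S, q%:M = char_poly_mx A *m S.
  exists (\sum_(i < size q) (q`_i)%:P *:
     (\sum_(j < i) x ^+ (i.-1 - j) * a ^+ j)).
  rewrite qx -[LHS]subr0 -[X in _ - X]qa -sumrB mulmx_sumr; apply: eq_bigr => i _.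
  by rewrite -scalerBr subrXX_comm // -scalemxAr.
have := congr1 determinant qS; rewrite det_scalar det_mulmx => ->.
exact: dvdp_mulr.
Qed.

(* Similarity through rectangular matrices, whose sizes are then equal. *)
Definition rsim m n (B : 'M[K]_m) (A : 'M[K]_n) (P : 'M[K]_(m, n)) Q :=
  [/\ P *m Q = 1%:M, Q *m P = 1%:M & B *m P = P *m A].

(** Block decompositions have sizes such as [n1 + n2], equal to [n] only propositionally; recovering
    the equality from the two inverses lets the proofs carry such sizes without casts. *)
Lemma rsim_size m n (B : 'M[K]_m) (A : 'M[K]_n) P Q : rsim B A P Q -> m = n.
Proof.
by case=> /mulmx1_min le_mn /mulmx1_min le_nm _; apply/anti_leq/andP.
Qed.

Lemma rsim_char_poly m n (B : 'M[K]_m) (A : 'M[K]_n) P Q :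
  rsim B A P Q -> char_poly B = char_poly A.
Proof.
move=> sBA; have eq_mn := rsim_size sBA; subst m.
case: sBA => PQ QP BP.
have unitP : map_mx (@polyC K) P \in unitmx.
  by rewrite map_unitmx; case/mulmx1_unit: PQ.
have detP : \det (map_mx (@polyC K) P) != 0.
  by move: unitP; rewrite unitmxE; apply: contraTneq => ->; rewrite unitr0.
apply: (mulIf detP); rewrite /char_poly -det_mulmx mulrC -det_mulmx.
by rewrite !mulmxBl !mulmxBr -!map_mxM BP scalar_mxC.
Qed.

Lemma xformable_rsim m n (B : 'M[K]_m) (A : 'M[K]_n) P Q :
  rsim B A P Q -> is_xform_mx B -> xformable A.
Proof.
move=> sBA; have eq_mn := rsim_size sBA; subst m.
case: sBA => PQ QP BP xB; have [unitP _] := mulmx1_unit PQ.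
exists P => //; rewrite /similar_to conjumx //.
have -> : invmx P = Q by rewrite -[LHS]mulmx1 -PQ mulKmx.
by rewrite -BP -mulmxA PQ mulmx1.
Qed.

Lemma rsim_xformable n (A : 'M[K]_n) : xformable A ->
  exists (B : 'M[K]_n) P Q, is_xform_mx B /\ rsim B A P Q.
Proof.
case=> P unitP xB; exists (conjmx P A), P, (invmx P); split=> //.
by split; rewrite ?mulmxV ?mulVmx ?conjumx // mulmxKV.
Qed.

End EvalMx.

(** * X-form matrices: the kernel obstruction, and the insertion of a 2x2 block *)

Section XForm.

Variable K : fieldType.
Implicit Types (p q pi : {poly K}).

Lemma evalmx_dvd l n (u : 'M[K]_(l, n)) (A : 'M[K]_n) p q :
  p %| q -> u *m evalmx A p = 0 -> u *m evalmx A q = 0.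
Proof.
by case/dvdpP=> r -> up; rewrite mulrC evalmxM mulmxA up mul0mx.
Qed.

Lemma evalmx_gcd l n (u : 'M[K]_(l, n)) (A : 'M[K]_n) p q :
  u *m evalmx A p = 0 -> u *m evalmx A q = 0 -> u *m evalmx A (gcdp p q) = 0.
Proof.
move=> up uq; have [[r s] /eqp_dvdl eq_gcd] := Bezoutp p q.
apply: (@evalmx_dvd _ _ _ _ (r * p + s * q)); first by rewrite eq_gcd.
by rewrite mulrC (mulrC s) evalmxD !evalmxM mulmxDr !mulmxA up uq !mul0mx addr0.
Qed.

(** The rows of [u] are also killed by the characteristic polynomial of [b], of degree at most 2,
    hence by its gcd with [pi ^+ m.+1]. This gcd is a proper divisor of that power, so it divides
    [pi ^+ m]. *)
Lemma ker_irredX_small l k (u : 'M[K]_(l, k)) (b : 'M[K]_k) pi m :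
    (k <= 2)%N -> irreducible_poly pi -> (3 < size (pi ^+ m.+1))%N ->
  u *m evalmx b (pi ^+ m.+1) = 0 -> u *m evalmx b (pi ^+ m) = 0.
Proof.
move=> k_le2 pi_irr pi_gt3 upi.
have ub : u *m evalmx b (char_poly b) = 0 by rewrite evalmx_char_poly mulmx0.
apply: evalmx_dvd (evalmx_gcd upi ub); apply: dvdp_irredX pi_irr (dvdp_gcdl _ _) _.
apply: leq_ltn_trans pi_gt3; apply: leq_trans (_ : k.+1 <= 3)%N => //.
by rewrite -(size_char_poly b) dvdp_leq ?dvdp_gcdr ?monic_neq0 ?char_poly_monic.
Qed.

(** The columns [f j] of [B] are supported on the rows in the image of [f], so the matrix [E]
    selecting these columns intertwines [B] with its small submatrix, and [ker_irredX_small] applies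
    to [u *m E]. *)
Lemma ker_irredX_cols l n k (u : 'M[K]_(l, n)) (B : 'M[K]_n) (f : 'I_k -> 'I_n)
    pi m :
    injective f -> (forall i j, (forall j', f j' != i) -> B i (f j) = 0) ->
    (k <= 2)%N -> irreducible_poly pi -> (3 < size (pi ^+ m.+1))%N ->
    u *m evalmx B (pi ^+ m.+1) = 0 ->
  forall i j, (u *m evalmx B (pi ^+ m)) i (f j) = 0.
Proof.
move=> f_inj B0 k_le2 pi_irr pi_gt3 upi i j.
pose E : 'M[K]_(n, k) := \matrix_(i, j) (f j == i)%:R.
have mulE d (M : 'M[K]_(d, n)) i' j' : (M *m E) i' j' = M i' (f j').
  rewrite mxE (bigD1 (f j')) //= mxE eqxx mulr1 big1 ?addr0 // => h neq_h.
  by rewrite mxE eq_sym (negPf neq_h) mulr0.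
have BE : B *m E = E *m mxsub f f B.
  apply/matrixP => i' j'; rewrite mulE mxE.
  have [[h <-] | no_h] := pselect (exists h, f h = i').
    rewrite (bigD1 h) //= !mxE eqxx mul1r big1 ?addr0 // => h' neq_h.
    by rewrite mxE (inj_eq f_inj) (negPf neq_h) mul0r.
  have no_h' h : f h != i' by apply/eqP => fh; apply: no_h; exists h.
  by rewrite B0 // big1 // => h _; rewrite mxE (negPf (no_h' h)) mul0r.
rewrite -mulE -mulmxA (evalmx_intertwine _ BE) mulmxA.
rewrite (ker_irredX_small k_le2 pi_irr pi_gt3) ?mxE //.
by rewrite -mulmxA -(evalmx_intertwine _ BE) mulmxA upi mul0mx.
Qed.

(** Column [j] of an X-form matrix is supported on the rows [j] and [rev_ord j], a set stable under
    [rev_ord]; so [ker_irredX_cols] applies with two columns, or with one at the centre. *)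
Lemma ker_irredX_xform l n (u : 'M[K]_(l, n)) (B : 'M[K]_n) pi m :
    is_xform_mx B -> irreducible_poly pi -> (3 < size (pi ^+ m.+1))%N ->
  u *m evalmx B (pi ^+ m.+1) = 0 -> u *m evalmx B (pi ^+ m) = 0.
Proof.
move=> /forallP xB pi_irr pi_gt3 upi; apply/matrixP => i j; rewrite [RHS]mxE.
have {}xB k h : h != k -> k != rev_ord h -> B k h = 0.
  move=> neq_hk neq_rev; apply/eqP.
  move/forallP: (xB k) => /(_ h)/implyP; apply; rewrite eq_sym neq_hk /=.
  apply: contra neq_rev => /eqP eq_n; rewrite -val_eqE /=.
  by rewrite -{2}eq_n subSS addnK.
have [rev_j | neq_j] := eqVneq (rev_ord j) j.
  apply: (ker_irredX_cols (f := fun _ : 'I_1 => j) _ _ _ pi_irr pi_gt3 upi i ord0) => //.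
    by move=> a b _; rewrite !ord1.
  move=> k _ /(_ ord0) neq_jk; apply: xB => //.
  by rewrite rev_j eq_sym.
pose f (a : 'I_2) := if a == ord0 then j else rev_ord j.
apply: (ker_irredX_cols (f := f) _ _ _ pi_irr pi_gt3 upi i ord0) => //.
  move=> a b; rewrite /f; case: (eqVneq a ord0); case: (eqVneq b ord0).
  - by move=> -> ->.
  - by move=> _ _ /esym/eqP; rewrite (negPf neq_j).
  - by move=> _ _ /eqP; rewrite (negPf neq_j).
  - by move: a b => [[|[|]]] // ? [[|[|]]] // ? _ _ _; apply: val_inj.
move=> k a neq_f.
have neq_jk : j != k by have := neq_f ord0.
have neq_rjk : rev_ord j != k by have := neq_f ord_max.
rewrite /f; case: eqP => _; apply: xB => //; first by rewrite eq_sym.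
by rewrite rev_ordK eq_sym.
Qed.

Lemma rsim_evalmx m n (B : 'M[K]_m) (A : 'M[K]_n) P Q p :
  rsim B A P Q -> evalmx B p *m P = P *m evalmx A p.
Proof. by case=> _ _; apply: evalmx_intertwine. Qed.

(** The obstruction to interiority: an X-formable matrix has no vector of order exactly [pi ^+ m.+1]
    once this power has degree above 2. *)
Lemma ker_irredX_xformable l n (u : 'M[K]_(l, n)) (A : 'M[K]_n) pi m :
    xformable A -> irreducible_poly pi -> (3 < size (pi ^+ m.+1))%N ->
  u *m evalmx A (pi ^+ m.+1) = 0 -> u *m evalmx A (pi ^+ m) = 0.
Proof.
case/rsim_xformable=> B [P [Q [xB sBA]]] pi_irr pi_gt3 upi.
have [PQ QP BP] := sBA.
have uQ p : u *m Q *m evalmx B p = u *m evalmx A p *m Q.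
  rewrite -[LHS]mulmx1 -PQ mulmxA -(mulmxA (u *m Q)) (rsim_evalmx _ sBA).
  by rewrite -!mulmxA (mulmxA Q P) QP mul1mx.
have := ker_irredX_xform (u := u *m Q) xB pi_irr pi_gt3.
rewrite !uQ upi mul0mx => /(_ erefl)/(congr1 (mulmx^~ P)).
by rewrite -mulmxA QP mulmx1 mul0mx.
Qed.

Lemma rsim_trans m n k (C : 'M[K]_k) (B : 'M[K]_m) (A : 'M[K]_n) P Q P' Q' :
  rsim C B P Q -> rsim B A P' Q' -> rsim C A (P *m P') (Q' *m Q).
Proof.
case=> PQ QP CP [PQ' QP' BP]; split.
- by rewrite mulmxA -(mulmxA P) PQ' mulmx1.
- by rewrite mulmxA -(mulmxA Q') QP mulmx1.
- by rewrite mulmxA CP -mulmxA BP mulmxA.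
Qed.

Lemma rsim_block n1 m n (A1 : 'M[K]_n1) (B : 'M[K]_m) (A : 'M[K]_n) P Q :
  rsim B A P Q ->
  rsim (block_mx A1 0 0 B) (block_mx A1 0 0 A)
       (block_mx 1%:M 0 0 P) (block_mx 1%:M 0 0 Q).
Proof.
case=> PQ QP BP; split; rewrite !mulmx_block !(mulmx0, mul0mx, mulmx1, mul1mx).
- by rewrite !(addr0, add0r) PQ -scalar_mx_block.
- by rewrite !(addr0, add0r) QP -scalar_mx_block.
- by rewrite !(addr0, add0r) BP.
Qed.

(* Conjugating by this bijection interleaves a 2x2 block with an X-form matrix:
   the block occupies the four corners. *)
Definition corners_first m (i : 'I_m.+2) : 'I_(2 + m) :=
  if unlift ord0 i is Some j then
    if unlift ord_max j is Some k then rshift 2 k else lshift m ord_max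
  else lshift m ord0.

Lemma corners_first_inj m : injective (@corners_first m).
Proof.
move=> i j; rewrite /corners_first.
case: unliftP => [i'|] ->; case: unliftP => [j'|] -> //;
 try (case: unliftP => [i''|] ->); try (case: unliftP => [j''|] ->) => //=;
 move/(congr1 val) => //=.
by rewrite !add2n => - [] /val_inj ->.
Qed.

Lemma xform_block m (a : 'M[K]_2) (d : 'M[K]_m) : is_xform_mx d ->
  exists (X : 'M[K]_m.+2) P Q, is_xform_mx X /\ rsim X (block_mx a 0 0 d) P Q.
Proof.
move=> /forallP xd; pose f := @corners_first m.
pose P : 'M[K]_(m.+2, 2 + m) := \matrix_(i, j) (f i == j)%:R.
have mulP k (M : 'M[K]_(2 + m, k)) i j : (P *m M) i j = M (f i) j.
  rewrite mxE (bigD1 (f i)) //= mxE eqxx mul1r big1 ?addr0 // => h neq_h.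
  by rewrite mxE eq_sym (negPf neq_h) mul0r.
have mulPT k (M : 'M[K]_(k, 2 + m)) i j : (M *m P^T) i j = M i (f j).
  rewrite mxE (bigD1 (f j)) //= !mxE eqxx mulr1 big1 ?addr0 // => h neq_h.
  by rewrite !mxE eq_sym (negPf neq_h) mulr0.
have PPT : P *m P^T = 1%:M.
  apply/matrixP => i j; rewrite mulPT !mxE.
  by rewrite (inj_eq (@corners_first_inj m)).
have PTP : P^T *m P = 1%:M by apply: (@mulmx1C _ m.+2).
exists (P *m block_mx a 0 0 d *m P^T), P, P^T; split; last first.
  by split=> //; rewrite -!mulmxA PTP mulmx1.
apply/forallP => i; apply/forallP => j; apply/implyP => /andP[neq_ij neq_m].
rewrite mulPT mulP /f /corners_first; move: neq_ij neq_m.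
case: unliftP => [i'|] ->; case: unliftP => [j'|] -> //;
 try (case: unliftP => [i''|] ->); try (case: unliftP => [j''|] ->) => //=;
 rewrite ?block_mxEul ?block_mxEur ?block_mxEdl ?block_mxEdr ?mxE ?eqxx //.
(* Both indices are away from the border. Each is one more than its index in [d], so the
   anti-diagonal of size [m.+2] induces that of size [m]. *)
- move=> neq_ij neq_m; move/forallP: (xd j') => /(_ j'')/implyP; apply.
  rewrite (inj_eq lift_inj) (inj_eq lift_inj) in neq_ij; rewrite neq_ij /=.
  apply: contra neq_m => /eqP sum_m; apply/eqP.
  have bump_m (k : 'I_m) : bump 0 (bump m k) = k.+1.
    by rewrite /bump (leqNgt m) ltn_ord.
  by rewrite !bump_m addSn addnS sum_m.
- by rewrite /= /bump /= add1n addn0 eqxx.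
Qed.

End XForm.

(** * Splitting along coprime factors, down to 2x2 blocks *)

Section Decomposition.

Variable K : fieldType.
Implicit Types (p q pi : {poly K}).

Lemma evalmx_kermxpoly n (A : 'M[K]_n) p : kermxpoly A p *m evalmx A p = 0.
Proof.
by case: n A => [|n] A; [apply/matrixP => - [] | rewrite /= mulmx_ker].
Qed.

Lemma kermxpoly_full n (A : 'M[K]_n) p : evalmx A p = 0 -> (kermxpoly A p :=: 1)%MS.
Proof.
case: n A => [|n] A pA0; first by rewrite !thinmx0.
by rewrite /= in pA0; rewrite /kermxpoly pA0; apply: kermx0.
Qed.

(** Matrices act on row vectors from the right, so stability of the rows of [U] is what kills the
    upper right block. *)
Lemma rsim_col_mx n1 n2 n (A : 'M[K]_n) (U : 'M[K]_(n1, n)) (W : 'M[K]_(n2, n)) :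
    row_free (col_mx U W) -> row_full (col_mx U W) -> stablemx U A ->
  exists C Z D P Q, rsim (block_mx C 0 Z D) A P Q /\ P = col_mx U W.
Proof.
move=> free_P full_P stabU; set P := col_mx U W in free_P full_P *.
have PQ : P *m pinvmx P = 1%:M by rewrite mulmxVp.
have QP : pinvmx P *m P = 1%:M by rewrite mulVpmx.
pose B := P *m A *m pinvmx P.
exists (ulsubmx B), (dlsubmx B), (drsubmx B), P, (pinvmx P); split=> //.
have urB : ursubmx B = 0.
  have -> : ursubmx B = rsubmx (U *m A *m pinvmx P).
    by rewrite /B -[P *m _ *m _]mulmxA /ursubmx -mul_usub_mx {1}/P col_mxKu mulmxA.
  have [C ->] := submxP stabU.
  have /(congr1 usubmx) : P *m pinvmx P = 1%:M by [].
  rewrite -mul_usub_mx col_mxKu scalar_mx_block col_mxKu -mulmxA => ->.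
  by rewrite mul_mx_row mulmx0 row_mxKr.
by split=> //; rewrite -urB submxK /B -mulmxA QP mulmx1.
Qed.

(** The kernels of [p] and [q] at [A] are stable and complementary. The block on the first is killed
    by [p], so its characteristic polynomial divides a power of [p], is prime to [q], and hence
    divides [p]; likewise for [q], and a count of sizes forces equality. *)
Lemma coprime_decomposition n (A : 'M[K]_n) p q :
    coprimep p q -> p \is monic -> q \is monic -> char_poly A = p * q ->
  exists n1 n2 (A1 : 'M[K]_n1) (A2 : 'M[K]_n2) P Q,
    [/\ rsim (block_mx A1 0 0 A2) A P Q, char_poly A1 = p & char_poly A2 = q].
Proof.
move=> cop p_m q_m charA.
pose U := row_base (kermxpoly A p); pose W := row_base (kermxpoly A q).
have UA : stablemx U A by rewrite stablemx_row_base comm_mx_stable_kermxpoly.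
have WA : stablemx W A by rewrite stablemx_row_base comm_mx_stable_kermxpoly.
have full : (U + W :=: 1)%MS.
  apply: eqmx_trans (adds_eqmx (eq_row_base _) (eq_row_base _)) _.
  apply: eqmx_trans (eqmx_sym (kermxpolyM _ cop)) _; apply: kermxpoly_full.
  by rewrite -charA evalmx_char_poly.
have cap : (U :&: W = 0)%MS.
  apply/eqP; rewrite -submx0 (cap_eqmx (eq_row_base _) (eq_row_base _)).
  by rewrite mxdirect_kermxpoly.
have rkUW : \rank (col_mx U W) = n by rewrite -addsmxE full mxrank1.
have sumr : (\rank (kermxpoly A p) + \rank (kermxpoly A q))%N = n.
  have := mxrank_sum_cap U W; rewrite cap mxrank0 addn0 full mxrank1.
  by rewrite !eq_row_base => <-.
have [||C [Z [D [P [Q [sim defP]]]]]] := rsim_col_mx (U := U) (W := W) _ _ UA.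
- by rewrite /row_free rkUW sumr.
- by rewrite /row_full rkUW.
have [PQ QP BP] := sim.
have CU : C *m U = U *m A.
  move: (congr1 usubmx BP); rewrite defP mul_block_col mul_col_mx !col_mxKu.
  by rewrite mul0mx addr0.
have ZD : Z *m U + D *m W = W *m A.
  by move: (congr1 dsubmx BP); rewrite defP mul_block_col mul_col_mx !col_mxKd.
have freeU : row_free U := row_base_free _.
have freeW : row_free W := row_base_free _.
(* [Z *m U] lies in the row space of [U] and, being [W *m A - D *m W], in that of [W]; the two meet
   in 0. *)
have Z0 : Z = 0.
  apply: (row_free_inj freeU); rewrite mul0mx; apply/eqP; rewrite -submx0 -cap.
  rewrite sub_capmx submxMl /= (_ : Z *m U = W *m A - D *m W).
    by rewrite addmx_sub ?eqmx_opp ?submxMl.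
  by rewrite -ZD addrK.
rewrite Z0 mul0mx add0r in ZD; rewrite Z0 in sim.
have Cp : evalmx C p = 0.
  apply: (row_free_inj freeU); rewrite mul0mx (evalmx_intertwine _ CU).
  have /submxP[T ->] : (U <= kermxpoly A p)%MS by rewrite eq_row_base.
  by rewrite -mulmxA evalmx_kermxpoly mulmx0.
have Dq : evalmx D q = 0.
  apply: (row_free_inj freeW); rewrite mul0mx (evalmx_intertwine _ ZD).
  have /submxP[T ->] : (W <= kermxpoly A q)%MS by rewrite eq_row_base.
  by rewrite -mulmxA evalmx_kermxpoly mulmx0.
have charCD : char_poly C * char_poly D = p * q.
  rewrite -charA -(rsim_char_poly sim) /char_poly char_block_diag_mx.
  by rewrite det_ublock.
have Cp_dv : char_poly C %| p.
  rewrite -(@Gauss_dvdpl _ _ q) -?charCD ?dvdp_mulr //.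
  apply: coprimep_dvdr (char_poly_dvdX Cp) _.
  exact: coprimep_expl.
have Dq_dv : char_poly D %| q.
  rewrite -(@Gauss_dvdpr _ _ p) -?charCD ?dvdp_mull //.
  apply: coprimep_dvdr (char_poly_dvdX Dq) _.
  by rewrite coprimep_expl // coprimep_sym.
have sizes : (size (char_poly C) + size (char_poly D) = size p + size q)%N.
  have := congr1 (fun p : {poly K} => (size p).+1) charCD.
  rewrite /= !size_mul ?monic_neq0 ?char_poly_monic //.
  by rewrite !prednK // ?addn_gt0 ?size_char_poly // size_poly_gt0 (monic_neq0 p_m).
have le1 := dvdp_leq (monic_neq0 p_m) Cp_dv.
have le2 := dvdp_leq (monic_neq0 q_m) Dq_dv.
have eq1 : size (char_poly C) = size p.
  apply/anti_leq; rewrite le1 /= -(leq_add2r (size (char_poly D))) sizes.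
  by rewrite leq_add2l.
have eq2 : size (char_poly D) = size q.
  by apply/eqP; rewrite -(eqn_add2l (size (char_poly C))) sizes eq1.
exists _, _, C, D, P, Q; split=> //; apply/eqP.
- by rewrite -eqp_monic ?char_poly_monic // -(dvdp_size_eqp Cp_dv) eq1.
- by rewrite -eqp_monic ?char_poly_monic // -(dvdp_size_eqp Dq_dv) eq2.
Qed.

Lemma small_mult_xform n (A : 'M[K]_n) : small_mult (char_poly A) ->
  exists m (B : 'M[K]_m) P Q, is_xform_mx B /\ rsim B A P Q.
Proof.
have [k le_nk] := ubnP n; elim: k => // k IHk in n A le_nk *.
move=> smA; have [n_le1 | n_gt1] := leqP n 1.
  exists n, A, 1%:M, 1%:M; split; last by split; rewrite ?mulmx1 ?mul1mx.
  apply/forallP => i; apply/forallP => j; apply/implyP => /andP[/eqP[]].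
  by apply: val_inj; case: n n_le1 i j {A le_nk smA} => [|[|]] // _ [[]] // ? [[]].
have [|p1 [p2 [charA p1_m p2_m cop sz]]] :=
  small_mult_split (char_poly_monic A) smA; first by rewrite size_char_poly.
have [n1 [n2 [A1 [A2 [P [Q [sim cA1 cA2]]]]]]] :=
  coprime_decomposition cop p1_m p2_m charA.
have n1_2 : n1 = 2%N by have := size_char_poly A1; rewrite cA1 sz => - [].
subst n1; have [||m [B [P2 [Q2 [xB simB]]]]] := IHk _ A2.
- have := rsim_size sim; rewrite add2n => def_n.
  by rewrite -ltnS (leq_trans _ le_nk) // -def_n.
- by rewrite cA2; apply: small_mult_dvd smA; rewrite charA dvdp_mull.
have [X [P3 [Q3 [xX simX]]]] := xform_block A1 xB.
exists m.+2, X, (P3 *m block_mx 1%:M 0 0 P2 *m P),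
  (Q *m (block_mx 1%:M 0 0 Q2 *m Q3)); split=> //.
exact: rsim_trans (rsim_trans simX (rsim_block A1 simB)) sim.
Qed.

Lemma small_mult_xformable n (A : 'M[K]_n) :
  small_mult (char_poly A) -> xformable A.
Proof.
by case/small_mult_xform=> m [B [P [Q [xB sim]]]]; apply: xformable_rsim sim xB.
Qed.

End Decomposition.

(** * Krylov subspaces, and raising the order of a vector *)

Section Peel.

Variable K : fieldType.
Implicit Types (p q pi : {poly K}).

Definition krylov n (u : 'rV[K]_n) (A : 'M[K]_n) d : 'M[K]_(d, n) :=
  \matrix_(i < d) (u *m A ^+ i).

Lemma mul_krylov n (u : 'rV[K]_n) (A : 'M[K]_n) d p : (size p <= d)%N ->
  u *m evalmx A p = poly_rV p *m krylov u A d.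
Proof.
move=> le_pd; rewrite [RHS]mulmx_sum_row.
rewrite -[p in LHS]coefK poly_def (big_ord_widen d (fun i => p`_i *: 'X^i)) //.
have -> : evalmx A (\sum_(i < d | (i < size p)%N) p`_i *: 'X^i) =
          \sum_(i < d | (i < size p)%N) evalmx A (p`_i *: 'X^i).
  by apply: big_morph; [exact: evalmxD | exact: evalmx0].
rewrite mulmx_sumr [in RHS](bigID (fun i : 'I_d => i < size p)%N) /=.
rewrite [X in _ + X]big1 ?addr0 => [|i]; last first.
  by rewrite -leqNgt mxE => le_pi; rewrite nth_default // scale0r.
apply: eq_bigr => i _.
rewrite rowK mxE -mul_polyC evalmxM evalmxC evalmxXn mul_scalar_mx.
by rewrite -scalemxAr.
Qed.

(** A linear relation is a polynomial of degree below that of [pi ^+ m.+1] killing [u]. If nonzero,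
    its gcd with this power would be a proper divisor, hence divide [pi ^+ m], which does not kill
    [u]. *)
Lemma krylov_free n (u : 'rV[K]_n) (A : 'M[K]_n) pi m :
    irreducible_poly pi -> u *m evalmx A (pi ^+ m.+1) = 0 ->
    u *m evalmx A (pi ^+ m) != 0 ->
  row_free (krylov u A (size (pi ^+ m.+1)).-1).
Proof.
move=> pi_irr u0 u1; rewrite -kermx_eq0; apply/rowV0P => c /sub_kermxP cK.
pose p := rVpoly c.
have le_pd : (size p <= (size (pi ^+ m.+1)).-1)%N by exact: size_poly.
have up : u *m evalmx A p = 0.
  by rewrite (mul_krylov _ _ le_pd) rVpolyK.
have h_neq0 : pi ^+ m.+1 != 0 by rewrite expf_neq0 ?irredp_neq0.
have dv : pi ^+ m.+1 %| p.
  apply: contraNT u1 => ndv; apply/eqP.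
  apply: evalmx_dvd (evalmx_gcd u0 up).
  apply: dvdp_irredX pi_irr (dvdp_gcdl _ _) _.
  rewrite ltn_neqAle dvdp_leq ?dvdp_gcdl // andbT.
  rewrite (dvdp_size_eqp (dvdp_gcdl _ _)).
  apply: contra ndv => /eqp_dvdl <-; exact: dvdp_gcdr.
have p0 : p = 0.
  apply: contraTeq dv => p_neq0; apply/negP => /(dvdp_leq p_neq0).
  by rewrite leqNgt (leq_ltn_trans le_pd) // ltn_predL size_poly_gt0.
by rewrite -[c]rVpolyK -/p p0 linear0.
Qed.

(** [pi] divides the minimal polynomial, a power of which is a multiple of the characteristic one.
    The cofactor [r] does not kill [A] by minimality, and any nonzero row of its value at [A] is a
    suitable [u]. *)
Lemma irredp_ker n (A : 'M[K]_n) pi : irreducible_poly pi ->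
  pi %| char_poly A -> exists2 u : 'rV_n, u != 0 & u *m evalmx A pi = 0.
Proof.
move=> pi_irr pi_char.
case: n A pi_char => [|n] A pi_char.
  have := dvdp_leq (monic_neq0 (char_poly_monic A)) pi_char.
  by rewrite size_char_poly leqNgt pi_irr.1.
have /(char_poly_dvdX (A := A)) dv : evalmx A (mxminpoly A) = 0.
  exact: mx_root_minpoly.
have /dvdpP[r def_min] := irredp_dvdX pi_irr (dvdp_trans pi_char dv).
have r_neq0 : r != 0.
  have := monic_neq0 (mxminpoly_monic A); rewrite def_min.
  by apply: contra_neq => ->; rewrite mul0r.
have rA_neq0 : horner_mx A r != 0.
  apply/eqP => /mxminpoly_min; rewrite def_min => /(dvdp_leq r_neq0).
  rewrite size_mul // ?irredp_neq0 // leqNgt.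
  by case: (size pi) pi_irr.1 => [|[|s]] // _; rewrite !addnS /= ltnS leq_addr.
have [i ri] : exists i, row i (horner_mx A r) != 0.
  apply: contrapT => no_i; case/eqP: rA_neq0; apply/row_matrixP => i.
  by rewrite row0; apply: contrapT => /eqP ri; apply: no_i; exists i.
exists (row i (horner_mx A r)) => //.
have := mx_root_minpoly A; rewrite def_min rmorphM /= => rpi.
by rewrite -row_mul /= mulmxE rpi row0.
Qed.

(** The Krylov space of a vector killed by [pi] is stable of dimension deg [pi]. On it the
    characteristic polynomial divides a power of [pi], so [pi] divides it, and equality follows by
    degree. The block [Z] is where the perturbation will act. *)
Lemma peel n (A : 'M[K]_n) pi : irreducible_poly pi -> pi \is monic ->
    pi %| char_poly A ->
  exists n2 (C : 'M[K]_((size pi).-1)) Z (A2 : 'M[K]_n2) P Q,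
   [/\ rsim (block_mx C 0 Z A2) A P Q, evalmx C pi = 0 &
       char_poly A = pi * char_poly A2].
Proof.
move=> pi_irr pi_m pi_char; have [u u_neq0 upi] := irredp_ker pi_irr pi_char.
pose d := (size pi).-1; pose U := krylov u A d.
have d_gt0 : (0 < d)%N by rewrite /d; case: (size pi) pi_irr.1 => [|[|]].
have freeU : row_free U.
  by apply: (@krylov_free _ u A pi 0) => //; rewrite ?expr1 // expr0 evalmx1 mulmx1.
have subU p : (u *m evalmx A p <= U)%MS.
  rewrite (divp_eq p pi) evalmxD mulmxDr mulrC evalmxM mulmxA upi mul0mx add0r.
  rewrite (@mul_krylov _ _ _ d) ?submxMl // -ltnS /d prednK ?size_poly_gt0.
    by rewrite ltn_modp irredp_neq0.
  exact: irredp_neq0.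
have stabU : stablemx U A.
  apply/row_subP => i; rewrite row_mul rowK -mulmxA.
  have -> : A ^+ i *m A = evalmx A ('X^(i.+1)) by rewrite evalmxXn exprSr mulmxE.
  exact: subU.
pose W := row_base (U^C)%MS.
have full : (U + W :=: 1)%MS.
  apply: eqmx_trans (adds_eqmx (eqmx_refl _) (eq_row_base _)) _.
  apply/eqmxP; rewrite submx1 sub1mx; exact: addsmx_compl_full.
have cap : (U :&: W = 0)%MS.
  apply/eqP; rewrite -submx0 (cap_eqmx (eqmx_refl _) (eq_row_base _)).
  by rewrite capmx_compl.
have rkU : \rank U = d by apply/eqP.
have rkUW : \rank (col_mx U W) = n by rewrite -addsmxE full mxrank1.
have sumr : (d + \rank (U^C)%MS)%N = n.
  have := mxrank_sum_cap U W; rewrite cap mxrank0 addn0 full mxrank1.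
  by rewrite !eq_row_base rkU => <-.
have [||C [Z [A2 [P [Q [sim defP]]]]]] := rsim_col_mx (U := U) (W := W) _ _ stabU.
- by rewrite /row_free rkUW sumr.
- by rewrite /row_full rkUW.
have [PQ QP BP] := sim.
have CU : C *m U = U *m A.
  move: (congr1 usubmx BP); rewrite defP mul_block_col mul_col_mx !col_mxKu.
  by rewrite mul0mx addr0.
have Cpi : evalmx C pi = 0.
  apply: (row_free_inj freeU); rewrite mul0mx (evalmx_intertwine _ CU).
  apply/row_matrixP => i; rewrite row0 row_mul rowK -evalmxXn -mulmxA.
  by rewrite evalmx_comm mulmxA upi mul0mx.
have charA : char_poly A = char_poly C * char_poly A2.
  rewrite -(rsim_char_poly sim) /char_poly /char_poly_mx map_block_mx /=.
  rewrite scalar_mx_block opp_block_mx add_block_mx map_mx0 subr0.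
  by rewrite det_lblock.
exists _, C, Z, A2, P, Q; split=> //; rewrite charA; congr (_ * _).
apply/eqP; rewrite -eqp_monic ?char_poly_monic // eqp_sym.
suff pi_dv : pi %| char_poly C.
  rewrite -(dvdp_size_eqp pi_dv) size_char_poly prednK //.
  by rewrite size_poly_gt0 irredp_neq0.
apply: contraLR (char_poly_dvdX Cpi) => pi'C.
have cop : coprimep (char_poly C) (pi ^+ d).
  by rewrite coprimep_expr // coprimep_sym irredp_dvd_coprime.
apply/negP => /(coprimep_dvdl)/(_ cop).
rewrite coprimepp size_char_poly => /eqP [] d0.
by rewrite -/d d0 in d_gt0.
Qed.

(* An element of order exactly pi^(k+1) in the K[X]-module defined by A. *)
Definition has_height pi k n (A : 'M[K]_n) :=
  exists2 v : 'rV_n, v *m evalmx A (pi ^+ k.+1) = 0 & v *m evalmx A (pi ^+ k) != 0.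

Lemma has_height_rsim pi k m n (B : 'M[K]_m) (A : 'M[K]_n) P Q :
  rsim B A P Q -> has_height pi k B -> has_height pi k A.
Proof.
move=> sim [v v0 v1]; have [PQ QP BP] := sim.
have vP p : v *m P *m evalmx A p = v *m evalmx B p *m P.
  by rewrite -!mulmxA (rsim_evalmx _ sim).
exists (v *m P); rewrite vP ?v0 ?mul0mx //.
apply: contra_neq v1 => /(congr1 (mulmx^~ Q)).
by rewrite mul0mx -mulmxA PQ mulmx1.
Qed.

(* If w has order h = pi^(k+1), choose E killing w A2^i for all i < deg h - 1 but
   not for i = deg h - 1; then v = (0, w) satisfies
   v h(A_t) = v h(A_0) + (t e, 0) since h is monic. *)
Lemma has_height_block pi k d n (C : 'M[K]_d.+1) (Z : 'M[K]_(n, d.+1))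
    (A2 : 'M[K]_n) :
    irreducible_poly pi -> pi \is monic -> evalmx C pi = 0 -> has_height pi k A2 ->
  exists (E : 'M[K]_(n, d.+1)) (a : K),
    forall t, t != a -> has_height pi k.+1 (block_mx C 0 (Z + t *: E) A2).
Proof.
move=> pi_irr pi_m Cpi [w w0 w1]; set h := pi ^+ k.+1 in w0.
have h_m : h \is monic by apply: monic_exp.
have freeK := krylov_free pi_irr w0 w1; rewrite -/h in freeK.
pose N := (size h).-1; rewrite -/N in freeK.
have szh : size h = N.+1 by rewrite prednK // size_poly_gt0 monic_neq0.
pose e : 'rV[K]_d.+1 := delta_mx 0 0.
(* The Krylov rows are free, so [pinvmx] is a right inverse and [E] can be prescribed on them: [e]
   on the last one, 0 on the others. *)
pose F : 'M[K]_(N, d.+1) := \matrix_(i < N, j < d.+1) ((i.+1 == N) && (j == 0))%:R.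
pose E := pinvmx (krylov w A2 N) *m F.
have wE i : (i < N)%N -> w *m A2 ^+ i *m E = (i.+1 == N)%:R *: e.
  move=> lt_iN; have -> : w *m A2 ^+ i = row (Ordinal lt_iN) (krylov w A2 N).
    by rewrite rowK.
  rewrite mulmxA -row_mul mulmxVp // -row_mul mul1mx; apply/rowP => j.
  by rewrite !mxE /= -natrM mulnb.
pose M t := block_mx C 0 (Z + t *: E) A2.
pose v : 'rV[K]_(d.+1 + n) := row_mx 0 w.
pose G t : 'M[K]_(d.+1 + n) := block_mx 0 0 (t *: E) 0.
have MG t : M t = M 0 + G t.
  by rewrite /M /G add_block_mx !addr0 scale0r addr0.
have colM t : M t *m col_mx 0 1%:M = col_mx 0 1%:M *m A2.
  rewrite /M mul_block_col mul_col_mx.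
  by rewrite !(mulmx0, mul0mx, mulmx1, mul1mx, add0r, addr0).
have rowM t : C *m row_mx 1%:M 0 = row_mx 1%:M 0 *m M t.
  rewrite /M mul_row_block mul_mx_row.
  by rewrite !(mulmx0, mul0mx, mulmx1, mul1mx, add0r, addr0).
have v_col : v *m col_mx 0 1%:M = w.
  by rewrite /v mul_row_col mul0mx add0r mulmx1.
have rsub l (x : 'M[K]_(l, d.+1 + n)) : x *m col_mx 0 1%:M = rsubmx x.
  by rewrite -[x in LHS]hsubmxK mul_row_col mulmx0 add0r mulmx1.
have vpow t i : (i <= N)%N ->
    v *m M t ^+ i = v *m M 0 ^+ i + ((i == N)%:R * t) *: row_mx e 0.
  elim: i => [|i IHi] lt_iN.
    case: eqP => [N0|_]; last by rewrite !expr0 mul0r scale0r addr0.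
    have: (1 < size h)%N.
      rewrite /h; have := size_exp pi k.+1.
      case: (size (pi ^+ k.+1)) => [|[|?]] //=;
      by case: (size pi) pi_irr.1 => [|[|?]].
    by rewrite szh -N0.
  rewrite !exprSr -!mulmxE !mulmxA IHi 1?ltnW // (ltn_eqF lt_iN).
  rewrite mul0r scale0r addr0 [in LHS](MG t) mulmxDr; congr (_ + _).
  have -> : v *m M 0 ^+ i *m G t =
            row_mx (t *: (rsubmx (v *m M 0 ^+ i) *m E)) 0.
    rewrite -[v *m M 0 ^+ i in LHS]hsubmxK /G mul_row_block.
    by rewrite !(mulmx0, add0r) -scalemxAr.
  have -> : rsubmx (v *m M 0 ^+ i) = w *m A2 ^+ i.
    rewrite -rsub -mulmxA -!evalmxXn (evalmx_intertwine _ (colM 0)).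
    by rewrite mulmxA v_col.
  rewrite wE // scalerA mulrC scale_row_mx.
  by rewrite scaler0.
have vh t : v *m evalmx (M t) h = v *m evalmx (M 0) h + t *: row_mx e 0.
  have lch : h`_N = 1 by move/monicP: h_m; rewrite lead_coefE.
  rewrite !evalmxE szh !big_ord_recr /= !mulmxDr -addrA; congr (_ + _).
    rewrite !mulmx_sumr; apply: eq_bigr => i _.
    by rewrite -!scalemxAr vpow 1?ltnW // (ltn_eqF (ltn_ord i)) mul0r scale0r addr0.
  by rewrite lch !scale1r vpow // eqxx mul1r.
pose x := lsubmx (v *m evalmx (M 0) h).
have vh0 : v *m evalmx (M 0) h = row_mx x 0.
  rewrite -[LHS]hsubmxK -rsub -mulmxA (evalmx_intertwine _ (colM 0)).
  by rewrite mulmxA v_col w0.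
(* The first entry of [x + t *: e] vanishes only at [- x 0 0]. The row obtained lives in the first
   block, where [M t] acts as [C], so one more factor [pi] kills it. *)
exists E, (- x 0 0) => t neq_t; rewrite -/(M t); exists v; last first.
  apply: contra neq_t; rewrite -/h vh vh0 scale_row_mx add_row_mx => /eqP/rowP.
  move=> /(_ (lshift n 0)); rewrite row_mxEl !mxE !eqxx mulr1 => /eqP.
  by rewrite addrC addr_eq0.
rewrite exprSr -/h evalmxM mulmxA vh vh0 scale_row_mx add_row_mx scaler0 addr0.
have -> : row_mx (x + t *: e) 0 = (x + t *: e) *m row_mx 1%:M (0 : 'M[K]_(_, n)).
  by rewrite mul_mx_row mulmx1 mulmx0.
by rewrite -mulmxA -(evalmx_intertwine _ (rowM t)) Cpi mul0mx mulmx0.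
Qed.

End Peel.

(** * Closures in matrix spaces, and the necessary condition for interior points *)

Section MatrixTopology.

Variable K : numFieldType.

Lemma continuous_sum (T : topologicalType) (I : Type) (s : seq I) (P : pred I)
    (f : I -> T -> K) :
  (forall i, continuous (f i)) -> continuous (fun x => \sum_(i <- s | P i) f i x).
Proof.
move=> f_cont; elim: s => [|i s IHs].
  under [X in continuous X]eq_fun do rewrite big_nil.
  by move=> x; apply: cst_continuous.
under [X in continuous X]eq_fun do rewrite big_cons.
case: (P i) => // x; exact: continuousD (f_cont i x) (IHs x).
Qed.

Lemma continuous_matrix (T : topologicalType) m n (f : T -> 'M[K]_(m, n)) :
  (forall i j, continuous (fun x => f x i j)) -> continuous f.
Proof.
move=> f_cont x A [P P_nbhs sPA].
suff : \forall y \near x, forall ij, P ij.1 ij.2 (f y ij.1 ij.2).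
  by apply: filterS => y Py; apply: sPA => i j; apply: (Py (i, j)).
apply: filter_forall => -[i j] /=; apply: (f_cont i j x); exact: P_nbhs.
Qed.

Lemma continuous_mulmx (T : topologicalType) m n p (f : T -> 'M[K]_(m, n))
    (g : T -> 'M[K]_(n, p)) :
    (forall i j, continuous (fun x => f x i j)) ->
    (forall i j, continuous (fun x => g x i j)) ->
  forall i j, continuous (fun x => (f x *m g x) i j).
Proof.
move=> f_cont g_cont i j.
under [X in continuous X]eq_fun do rewrite mxE.
by apply: continuous_sum => k x; apply: continuousM; [apply: f_cont|apply: g_cont].
Qed.

Lemma continuous_block_mx (T : topologicalType) m1 m2 n1 n2
    (f11 : T -> 'M[K]_(m1, n1)) (f12 : T -> 'M[K]_(m1, n2))
    (f21 : T -> 'M[K]_(m2, n1)) (f22 : T -> 'M[K]_(m2, n2)) :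
    (forall i j, continuous (fun x => f11 x i j)) ->
    (forall i j, continuous (fun x => f12 x i j)) ->
    (forall i j, continuous (fun x => f21 x i j)) ->
    (forall i j, continuous (fun x => f22 x i j)) ->
  forall i j, continuous (fun x => block_mx (f11 x) (f12 x) (f21 x) (f22 x) i j).
Proof.
move=> c11 c12 c21 c22 i j; rewrite -(splitK i) -(splitK j).
case: (split i) => i'; case: (split j) => j' /=.
- by under [X in continuous X]eq_fun do rewrite block_mxEul; apply: c11.
- by under [X in continuous X]eq_fun do rewrite block_mxEur; apply: c12.
- by under [X in continuous X]eq_fun do rewrite block_mxEdl; apply: c21.
- by under [X in continuous X]eq_fun do rewrite block_mxEdr; apply: c22.
Qed.

(** [f] is only asked to send [S] into the closure of [S']; this is what composes two successive
    approximations. *)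
Lemma closure_image (T U : topologicalType) (f : T -> U) (S : set T) (S' : set U) x :
  {for x, continuous f} -> (forall y, S y -> closure S' (f y)) ->
  closure S x -> closure S' (f x).
Proof.
move=> f_cont fS Sx B; rewrite nbhsE => -[O [Oopen Ofx] sOB].
have [|y [Sy Oy]] := Sx (f @^-1` O).
  by apply: f_cont; apply: open_nbhs_nbhs.
have [z [Sz Oz]] := fS y Sy O (open_nbhs_nbhs (conj Oopen Oy)).
by exists z; split=> //; apply: sOB.
Qed.

Lemma nonroot_near0 (r : {poly K}) (V : set K) :
  r != 0 -> nbhs 0 V -> exists2 t, V t & ~~ root r t.
Proof.
move=> r_neq0 /nbhs_ballP[e /= e_gt0 sV].
(* These are [size r] distinct points, more than [r] has roots; denominators starting at 2 keep them
   inside the open ball. *)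
pose s := [seq e / k.+2%:R | k <- iota 0 (size r)].
have s_uniq : uniq s.
  rewrite map_inj_uniq ?iota_uniq // => i j /(mulfI (lt0r_neq0 e_gt0)).
  by move/invr_inj/eqP; rewrite eqr_nat => /eqP [].
have [all_root|] := boolP (all (root r) s).
  by have := max_poly_roots r_neq0 all_root s_uniq; rewrite size_map size_iota ltnn.
case/allPn => _ /mapP[k _ ->] nroot; exists (e / k.+2%:R) => //.
apply: sV; rewrite -ball_normE /= sub0r normrN ger0_norm.
  by rewrite ltr_pdivrMr ?ltr0n // ltr_pMr // ltr1n.
by rewrite divr_ge0 ?ler0n // ltW.
Qed.

Lemma closure_line m n (A E : 'M[K]_(m, n)) (r : {poly K}) (S : set 'M[K]_(m, n)) :
    r != 0 -> (forall t, ~~ root r t -> S (A + t *: E)) ->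
  closure S A.
Proof.
move=> r_neq0 S_line B B_nbhs.
have line_cont : continuous (fun t : K => A + t *: E).
  apply: continuous_matrix => i j.
  under [X in continuous X]eq_fun do rewrite !mxE.
  move=> t; apply: (@continuousD K K K (fun=> A i j) (fun t => t * E i j)).
    exact: cst_continuous.
  by apply: continuousM => //; apply: cst_continuous.
have [|t Bt nroot] := @nonroot_near0 r ((fun t : K => A + t *: E) @^-1` B) r_neq0.
  by apply: line_cont; rewrite scale0r addr0.
by exists (A + t *: E); split=> //; apply: S_line.
Qed.

(** Induction on [k]. After peeling [pi], the induction hypothesis approximates [A2]; near each
    approximant, [has_height_block] moves [Z] along a line with a single bad parameter. [P] and [Q]
    carry the blocks back to the size of [A]. *)
Lemma closure_has_height n (A : 'M[K]_n) pi k :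
    irreducible_poly pi -> pi \is monic -> pi ^+ k.+1 %| char_poly A ->
  closure [set B | has_height pi k B] A.
Proof.
move=> pi_irr pi_m; elim: k n A => [|k IHk] n A pik.
  apply: subset_closure; rewrite expr1 in pik.
  have [u u_neq0 upi] := irredp_ker pi_irr pik.
  by exists u; rewrite ?expr1 // expr0 evalmx1 mulmx1.
have pi_char : pi %| char_poly A by apply: dvdp_trans pik; rewrite exprS dvdp_mulr.
have [n2 [C [Z [A2 [P [Q [sim Cpi charA]]]]]]] := peel pi_irr pi_m pi_char.
have pi_neq0 := irredp_neq0 pi_irr.
have pik2 : pi ^+ k.+1 %| char_poly A2.
  by move: pik; rewrite charA exprS dvdp_mul2l.
case def_d : (size pi).-1 C Z P Q sim Cpi => [|d] C Z P Q sim Cpi.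
  by move: def_d pi_irr.1; case: (size pi) => [|[|]].
have [PQ QP BP] := sim.
pose f (B : 'M[K]_n2) := Q *m block_mx C 0 Z B *m P.
have defA : A = f A2 by rewrite /f -mulmxA BP mulmxA QP mul1mx.
have fsim B : rsim (block_mx C 0 Z B) (f B) P Q.
  by split=> //; rewrite /f !mulmxA PQ mul1mx.
rewrite defA; apply: (closure_image (S := [set B | has_height pi k B])).
- apply: continuous_matrix => i j; apply: continuous_mulmx => {i j} i j.
    apply: continuous_mulmx => {i j} i j; first by move=> x; apply: cst_continuous.
    by apply: continuous_block_mx => {i j} i j x;
      first [apply: cst_continuous | apply: coord_continuous].
  by move=> x; apply: cst_continuous.
- move=> B /(has_height_block Z pi_irr pi_m Cpi)[E [a hE]].
  apply: (@closure_line _ _ _ (Q *m block_mx 0 0 E 0 *m P) ('X - a%:P)).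
    by rewrite polyXsubC_eq0.
  move=> t; rewrite root_XsubC => /hE; apply: has_height_rsim (_ : rsim _ _ P Q).
  split=> //; rewrite mulmxDr /f !mulmxA PQ mul1mx -scalemxAr !mulmxA PQ mul1mx.
  rewrite scalemxAl -mulmxDl scale_block_mx add_block_mx !scaler0 !addr0.
  by [].
- exact: IHk.
Qed.

Lemma interior_small_mult n (A : 'M[K]_n) :
  interior [set B : 'M[K]_n | xformable B] A -> small_mult (char_poly A).
Proof.
move=> intA pi m pi_irr pim; rewrite leqNgt; apply/negP => pi_gt3.
have m_gt0 : (0 < m)%N by case: m pi_gt3 {pim} => //; rewrite expr0 size_poly1.
(* The perturbation lemmas need a monic polynomial; rescaling [pi] changes neither sizes nor
   divisibility. *)
pose sc := (lead_coef pi)^-1; pose mu := sc *: pi.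
have pi_neq0 := irredp_neq0 pi_irr.
have sc_neq0 : sc != 0 by rewrite invr_eq0 lead_coef_eq0.
have eqp_mu : mu %= pi by rewrite eqp_scale.
have mu_m : mu \is monic by rewrite monicE lead_coefZ mulVf // lead_coef_eq0.
have mu_irr : irreducible_poly mu.
  split=> [|q q_neq1]; first by rewrite size_scale //; apply: pi_irr.1.
  rewrite (eqp_dvdr _ eqp_mu) => /(pi_irr.2 _ q_neq1) qpi.
  by rewrite (eqp_trans qpi) // eqp_sym.
have eqp_mum : mu ^+ m %= pi ^+ m by apply: eqp_exp.
have mu_gt3 : (3 < size (mu ^+ m))%N by rewrite (eqp_size eqp_mum).
have mum : mu ^+ m %| char_poly A by rewrite (eqp_dvdl _ eqp_mum).
case: m m_gt0 mu_gt3 mum {pim pi_gt3 eqp_mum} => // k _ mu_gt3 muk.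
have := closure_has_height mu_irr mu_m muk.
move=> /(_ _ intA)[B [[v v0 v1] xB]].
by case/eqP: v1; apply: (ker_irredX_xformable xB mu_irr mu_gt3).
Qed.

End MatrixTopology.

(** * Density through separable characteristic polynomials *)

Section Density.

Variable K : numFieldType.

Lemma separable_small_mult (p : {poly K}) :
    (forall pi : {poly K}, irreducible_poly pi -> (size pi <= 3)%N) ->
  separable_poly p -> small_mult p.
Proof.
move=> irr_le3 sep_p pi [|[|m]] pi_irr pim.
- by rewrite expr0 size_poly1.
- by rewrite expr1 irr_le3.
have pi2_p : pi * pi %| p by apply: dvdp_trans pim; rewrite !exprS mulrA dvdp_mulr.
have [/(_ _ _ pi2_p)] := separable_polyP sep_p.
by rewrite coprimepp => /eqP pi1; have := pi_irr.1; rewrite pi1.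
Qed.

(* The discriminant of the characteristic polynomial of A + t (B - A), with B
   diagonal with distinct eigenvalues, is a polynomial in t not vanishing at 1. *)
Lemma closure_separable n (A : 'M[K]_n) : (0 < n)%N ->
  closure [set B : 'M[K]_n | separable_poly (char_poly B)] A.
Proof.
move=> n_gt0; pose B : 'M[K]_n := diag_mx (\row_i (val i)%:R).
pose M : 'M[{poly K}]_n := map_mx polyC A + 'X *: map_mx polyC (B - A).
pose q := char_poly M; pose res := resultant q q^`().
have evM t : map_mx (horner_eval t) M = A + t *: (B - A).
  by apply/matrixP => i j; rewrite !mxE /horner_eval !hornerE.
(* The leading coefficients 1 of [q] and [n] of its derivative survive evaluation at any [t], so the
   resultant commutes with evaluation. *)
have q'n : q^`()`_n.-1 = n%:R.
  rewrite coef_deriv prednK //.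
  have /monicP := char_poly_monic M.
  by rewrite lead_coefE size_char_poly -/q => ->.
have nX t : horner_eval t (n%:R : {poly K}) != 0.
  by rewrite /horner_eval -polyC_natr hornerC pnatr_eq0 -lt0n.
have size_q' : size q^`() = n.
  apply/anti_leq/andP; split.
    by have := lt_size_deriv (monic_neq0 (char_poly_monic M)); rewrite size_char_poly.
  rewrite leqNgt; apply/negP => lt_qn; have := nX 0.
  rewrite -q'n nth_default ?raddf0 ?eqxx //.
  by rewrite -ltnS prednK.
have resE t : res.[t] = resultant (char_poly (A + t *: (B - A)))
                                  (char_poly (A + t *: (B - A)))^`().
  rewrite -evM -map_char_poly deriv_map -[LHS]/(horner_eval t res) map_resultant //.
    by rewrite (monicP (char_poly_monic M)) rmorph1 oner_eq0.
  by rewrite lead_coefE size_q' q'n; exact: nX.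
have sepE t : ~~ root res t = separable_poly (char_poly (A + t *: (B - A))).
  rewrite rootE resE resultant_eq0 -leqNgt separable_poly.unlock /coprimep leq_eqVlt.
  rewrite ltnS leqn0 size_poly_eq0 gcdp_eq0 (negPf (monic_neq0 (char_poly_monic _))).
  by rewrite orbF.
apply: (@closure_line _ _ _ _ (B - A) res) => [|t]; last by rewrite sepE.
suff : ~~ root res 1 by apply: contraNneq => ->; rewrite root0.
rewrite sepE scale1r addrC subrK char_poly_trig ?diag_mx_is_trig //.
rewrite -(big_map (fun i => B i i) predT (fun x => 'X - x%:P)) separable_prod_XsubC.
rewrite map_inj_uniq ?index_enum_uniq // => i j.
rewrite !mxE !eqxx !mulr1n => /eqP; rewrite eqr_nat => /eqP; exact: val_inj.
Qed.

Lemma dense_xformable n : (0 < n)%N ->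
    (forall pi : {poly K}, irreducible_poly pi -> (size pi <= 3)%N) ->
  dense [set A : 'M[K]_n | xformable A].
Proof.
move=> n_gt0 irr_le3 O [A OA] O_open.
have [B [sepB OB]] := @closure_separable n A n_gt0 _ (open_nbhs_nbhs (conj O_open OA)).
by exists B; split=> //; apply/small_mult_xformable/separable_small_mult.
Qed.

End Density.

(** * Continuity of the coefficients of the characteristic polynomial *)

Section CharPolyContinuous.

Variable K : numFieldType.

Definition coef_continuous (T : topologicalType) (F : T -> {poly K}) :=
  forall k, continuous (fun x => (F x)`_k).

Lemma coef_continuous_cst (T : topologicalType) p : coef_continuous (fun _ : T => p).
Proof. by move=> k x; apply: cst_continuous. Qed.

Lemma coef_continuousM (T : topologicalType) (F G : T -> {poly K}) :
  coef_continuous F -> coef_continuous G -> coef_continuous (fun x => F x * G x).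
Proof.
move=> F_cont G_cont k; under [X in continuous X]eq_fun do rewrite coefM.
apply: continuous_sum => i x; exact: continuousM (F_cont i x) (G_cont (k - i)%N x).
Qed.

Lemma coef_continuous_char_poly n : coef_continuous (fun A : 'M[K]_n => char_poly A).
Proof.
move=> k; rewrite /char_poly /determinant.
under [X in continuous X]eq_fun do rewrite coef_sum.
apply: continuous_sum => s.
suff prod_cont : coef_continuous (fun A : 'M[K]_n => \prod_i char_poly_mx A i (s i)).
  exact: (coef_continuousM (@coef_continuous_cst _ _) prod_cont).
elim: (index_enum _) => [|i r IHr] {}k.
  under [X in continuous X]eq_fun do rewrite big_nil.
  exact: coef_continuous_cst.
under [X in continuous X]eq_fun do rewrite big_cons.
apply: (coef_continuousM _ IHr) => {}k.
under [X in continuous X]eq_fun do rewrite !mxE coefB coefC.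
move=> A; apply: (@continuousB K K _ (fun=> _)
  (fun A : 'M[K]_n => if k == 0%N then A i (s i) else 0)).
  exact: cst_continuous.
by case: eqP => _; [apply: coord_continuous | apply: cst_continuous].
Qed.

Lemma near_char_poly n (A : 'M[K]_n) (d : K) : 0 < d ->
  \forall B \near A, forall k, `|(char_poly B)`_k - (char_poly A)`_k| < d.
Proof.
move=> d_gt0.
suff : \forall B \near A, forall k : 'I_n.+1,
    `|(char_poly B)`_k - (char_poly A)`_k| < d.
  apply: filterS => B close k; have [lt_kn | le_nk] := ltnP k n.+1.
    exact: (close (Ordinal lt_kn)).
  by rewrite !nth_default ?size_char_poly // subrr normr0.
apply: (@filter_forall _ _ (fun (k : 'I_n.+1) (B : 'M[K]_n) =>
  `|(char_poly B)`_k - (char_poly A)`_k| < d) (nbhs A)) => k.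
have /cvgr_dist_lt/(_ _ d_gt0) := @coef_continuous_char_poly n k A.
by apply: filterS => B; rewrite distrC.
Qed.

End CharPolyContinuous.

(** * Continuity of roots counted with multiplicity *)

Section RootContinuity.

Variable K : numFieldType.
Implicit Types (s t : seq K) (p : {poly K}).

Local Notation prodX s := (\prod_(x <- s) ('X - x%:P)).

Lemma pos_lower_bound s : all (fun x => 0 < x) s ->
  exists2 c : K, 0 < c & all (fun x => c <= x) s.
Proof.
elim: s => [|a s IHs] /=; first by exists 1.
case/andP=> a_gt0 /IHs[c c_gt0 /allP c_le]; have ac_gt0 := addr_gt0 a_gt0 c_gt0.
(* The order of [K] may be partial, as on the complex numbers; this quotient replaces a minimum and
   lies below both [a] and [c]. *)
exists (a * c / (a + c)); first by rewrite divr_gt0 ?mulr_gt0.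
rewrite ler_pdivrMr // ler_pM2l // lerDr (ltW a_gt0) /=.
apply/allP => x /c_le; apply: le_trans.
by rewrite ler_pdivrMr // mulrC ler_pM2l // lerDl ltW.
Qed.

(* Recursion satisfied by the coefficients in a synthetic division by X - mu with
   |mu| <= M. *)
Fixpoint synth_bound (M : K) j := if j is j'.+1 then 1 + M * synth_bound M j' else 0.

Lemma synth_bound_ge0 M j : 0 <= M -> 0 <= synth_bound M j.
Proof. by move=> M_ge0; elim: j => //= j IHj; rewrite addr_ge0 ?mulr_ge0. Qed.

(** Each coefficient of [p] is one coefficient of the product plus [mu] times the next coefficient
    of [p]; the bound is propagated downwards from index [N], where [p] has vanished. *)
Lemma coef_divXsubC p (mu M eta : K) N : 0 <= M -> 0 <= eta -> `|mu| <= M ->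
    (size p <= N)%N -> (forall k, `|(('X - mu%:P) * p)`_k| <= eta) ->
  forall k, `|p`_k| <= eta * synth_bound M N.
Proof.
move=> M_ge0 eta_ge0 mu_le p_le coef_le.
suff bound j k : (N <= k + j)%N -> `|p`_k| <= eta * synth_bound M j.
  by move=> k; apply: bound; apply: leq_addl.
elim: j k => [|j IHj] k le_Nk.
  by rewrite nth_default ?normr0 ?mulr0 // (leq_trans p_le) // -[k]addn0.
have -> : p`_k = (('X - mu%:P) * p)`_k.+1 + mu * p`_k.+1.
  by rewrite mulrBl coefB coefXM coefCM subrK.
apply: le_trans (ler_normD _ _) _; rewrite /= mulrDr mulr1 lerD //.
rewrite normrM mulrCA ler_pM ?normr_ge0 // IHj //.
by rewrite addSnnS.
Qed.

Lemma root_close s (lam e : K) : 0 < e -> `|(prodX s).[lam]| < e ^+ size s ->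
  exists2 x, x \in s & `|x - lam| < e.
Proof.
move=> e_gt0 small; apply: contrapT => none; move: small.
suff far : e ^+ size s <= `|(prodX s).[lam]| by rewrite real_ltNge ?far ?normr_real //
  realX ?gtr0_real.
have {none} : all (fun x => e <= `|x - lam|) s.
  apply/allP => x xs; rewrite real_leNgt ?normr_real ?gtr0_real //.
  by apply/negP => close; apply: none; exists x.
elim: s => [|x s IHs] /=; first by rewrite big_nil hornerC normr1.
case/andP=> e_le /IHs{}IHs.
rewrite big_cons hornerM normrM exprS hornerXsubC distrC.
by apply: ler_pM => //; rewrite ?exprn_ge0 // ltW.
Qed.

Lemma size_prodX s : size (prodX s) = (size s).+1.
Proof. by rewrite size_prod_XsubC. Qed.

(** Closeness of coefficients makes [prodX s] small at [lam], so some root [mu] of [s] is near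
    [lam]; dividing it out leaves a polynomial still close to [prodX t], and the induction
    proceeds. *)
Lemma roots_close t (e : K) : 0 < e ->
  exists2 d : K, 0 < d & forall s, size s = size t ->
    (forall k, `|(prodX s)`_k - (prodX t)`_k| <= d) ->
  exists2 s', perm_eq s' s & all2 (fun x y => `|x - y| < e) s' t.
Proof.
move=> e_gt0; elim: t => [|lam t [d' d'_gt0 IHt]].
  by exists 1 => // s /size0nil-> _; exists [::].
(* [M] will bound the norm of [mu], [c] the loss in dividing by ['X - mu%:P], [B] the coefficients
   of [prodX t], and [L] the cost of evaluating at [lam]. The added 1 in [c], [B] and [L] makes them
   positive. *)
set n := size t; pose M := `|lam| + 1; pose c := synth_bound M n.+1 + 1.
pose B := 1 + \sum_(k < n.+1) `|(prodX t)`_k|.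
pose L := 1 + \sum_(k < n.+2) `|lam| ^+ k.
have M_ge0 : 0 <= M by rewrite addr_ge0.
have c_gt0 : 0 < c by rewrite ltr_wpDl ?synth_bound_ge0.
have B_gt0 : 0 < B by rewrite ltr_pwDl ?sumr_ge0.
have L_gt0 : 0 < L by rewrite ltr_pwDl ?sumr_ge0 // => k _; rewrite exprn_ge0.
have B_le k : `|(prodX t)`_k| <= B.
  have [lt_kn | le_nk] := ltnP k n.+1; last first.
    by rewrite nth_default ?normr0 ?ltW // size_prodX.
  rewrite /B (bigD1 (Ordinal lt_kn)) //= addrCA lerDl addr_ge0 ?sumr_ge0 //.
(* s has a root mu within e2 of lam; e2 and d make the coefficients of
   prodX s / (X - mu) and prodX t differ by at most d'. *)
have [|e2 e2_gt0 /and4P[e2_le1 e2_le_e e2_le _]] :=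
  pos_lower_bound (s := [:: 1; e; d' / 2%:R / c / B]).
- by rewrite /= ltr01 e_gt0 !divr_gt0.
have [|d d_gt0 /and3P[d_le1 d_le2 _]] :=
  pos_lower_bound (s := [:: d' / 2%:R / c; e2 ^+ n.+1 / 2%:R / L]).
- by rewrite /= !divr_gt0 ?exprn_gt0.
exists d => // s size_s close.
have [mu mu_s mu_lam] : exists2 x, x \in s & `|x - lam| < e2.
  apply: root_close => //; rewrite size_s /=.
  have -> : (prodX s).[lam] = (prodX s - prodX (lam :: t)).[lam].
    by rewrite hornerD hornerN big_cons hornerM hornerXsubC subrr mul0r subr0.
  rewrite (@horner_coef_wide _ n.+2); last first.
    by rewrite (leq_trans (size_polyD _ _)) // size_polyN !size_prodX size_s maxnn.
  apply: (@le_lt_trans _ _ (d * L)).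
    apply: le_trans (ler_norm_sum _ _ _) _; rewrite mulrDr mulr_sumr mulr1.
    apply: ler_wpDl; first exact: ltW.
    by apply: ler_sum => k _; rewrite normrM normrX ler_wpM2r ?exprn_ge0 // coefB.
  rewrite -ltr_pdivlMr //; apply: le_lt_trans d_le2 _.
  rewrite ltr_pM2r ?invr_gt0 // ltr_pdivrMr // ltr_pMr ?exprn_gt0 //.
  by rewrite ltr1n.
have perm_s := perm_to_rem mu_s; set s1 := rem mu s in perm_s.
have size_s1 : size s1 = size t by rewrite size_rem // size_s.
have prod_s : prodX s = ('X - mu%:P) * prodX s1.
  by rewrite (perm_big _ perm_s) big_cons.
have mu_le : `|mu| <= M.
  rewrite -(subrK lam mu) (le_trans (ler_normD _ _)) // addrC lerD2l.
  exact: le_trans (ltW mu_lam) e2_le1.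
have [||s' perm_s' close_s'] := IHt s1 => //.
  move=> k; rewrite -coefB.
  (* The product of ['X - mu%:P] with [prodX s1 - prodX t] is the given difference, bounded by [d],
     plus [mu - lam] times [prodX t], bounded by [e2 * B]. *)
  pose eta := d + e2 * B.
  apply: le_trans (_ : eta * synth_bound M n.+1 <= _).
    apply: (@coef_divXsubC _ mu) => //.
    - by rewrite addr_ge0 ?mulr_ge0 ?ltW.
    - rewrite (leq_trans (size_polyD _ _)) // size_polyN !size_prodX size_s1.
      by rewrite maxnn.
    move=> {}k; have -> : ('X - mu%:P) * (prodX s1 - prodX t) =
       (prodX s - prodX (lam :: t)) + (mu - lam)%:P * prodX t.
      rewrite prod_s big_cons polyCB; ring.
    rewrite coefD coefB coefCM (le_trans (ler_normD _ _)) // lerD //.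
    by rewrite normrM ler_pM // ltW.
  apply: le_trans (_ : eta * c <= _).
    by rewrite ler_wpM2l ?lerDl // addr_ge0 ?mulr_ge0 ?ltW.
  rewrite -ler_pdivlMr // (_ : d' / c = d' / 2%:R / c + d' / 2%:R / c).
    by rewrite lerD // -ler_pdivlMr.
  by rewrite -mulrDl -splitr.
exists (mu :: s'); last by rewrite /= close_s' (lt_le_trans mu_lam).
by rewrite (perm_trans _ (_ : perm_eq (mu :: s1) s)) ?perm_cons // perm_sym.
Qed.

Lemma count_all2 (r : rel K) (a b : pred K) s t :
    (forall x y, r x y -> a x -> b y) -> all2 r s t ->
  (count a s <= count b t)%N.
Proof.
move=> r_ab; elim: s t => [|x s IHs] [|y t] //= /andP[rxy /IHs le_st].
apply: leq_add le_st; case ax: (a x) => //; by rewrite (r_ab _ _ rxy ax).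
Qed.

Lemma roots_separation t : exists2 e : K, 0 < e &
  forall x y, x \in t -> y \in t -> `|x - y| < e -> x = y.
Proof.
pose l := [seq (if x == y then 1 else `|x - y|) | x <- t, y <- t].
have [|e e_gt0 /allP e_le] := @pos_lower_bound l.
  apply/allP => _ /allpairsP[[x y] [_ _ ->]] /=.
  by case: eqVneq => [_|neq_xy]; rewrite ?ltr01 // normr_gt0 subr_eq0.
exists e => // x y xt yt close; apply/eqP; apply: contraTT close => neq_xy.
have le_e : e <= `|x - y|.
  apply: e_le; apply/allpairsP; exists (x, y); split=> //=.
  by rewrite (negPf neq_xy).
by apply/negP => /lt_le_trans/(_ le_e); rewrite ltxx.
Qed.

End RootContinuity.

(** * Roots of nearby matrices and their clusters *)

Section NearRoots.

Variable K : numFieldType.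
Implicit Types (s t : seq K).

Local Notation prodX s := (\prod_(x <- s) ('X - x%:P)).

Lemma near_roots n (A : 'M[K]_n) t (e : K) : 0 < e -> char_poly A = prodX t ->
  \forall B \near A, forall s, char_poly B = prodX s ->
    exists2 s', perm_eq s' s & all2 (fun x y => `|x - y| < e) s' t.
Proof.
move=> e_gt0 charA; have [d d_gt0 close] := roots_close t e_gt0.
apply: filterS (near_char_poly A d_gt0) => B near_B s charB; apply: close.
  by apply: succn_inj; rewrite -!size_prodX -charA -charB !size_char_poly.
by move=> k; rewrite -charA -charB ltW.
Qed.

(** By separation the elements of [t] satisfying [a] all equal [y]. The radius is doubled because
    they will be compared with [y] through a third point within [e] of both. *)
Lemma cluster t (e : K) (a : pred K) y :
    (forall x y, x \in t -> y \in t -> `|x - y| < e + e -> x = y) ->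
    y \in t -> (forall x, a x -> `|x - y| < e + e) ->
  (count a t <= count_mem y t)%N.
Proof.
move=> sep yt a_near.
rewrite -[in leqLHS](eq_in_count (a1 := predI a (mem t))); last first.
  by move=> x xt /=; rewrite xt andbT.
apply: sub_count => x /= /andP[/a_near close xt]; apply/eqP; exact: sep.
Qed.

End NearRoots.

(** * Openness of (P) over the complex numbers *)

Section ComplexSmallMult.

Variable R : realType.
Local Notation C := R[i].
Implicit Types (z : C) (s t : seq C).

Local Notation prodX s := (\prod_(x <- s) ('X - x%:P)).

Lemma monic_prodX (p : {poly C}) : p \is monic -> exists s, p = prodX s.
Proof.
move=> p_m; have [s def_p] := closed_field_poly_normal p; exists s.
by rewrite {1}def_p (monicP p_m) scale1r.
Qed.

Lemma irredp_closed_size2 (pi : {poly C}) : irreducible_poly pi -> size pi = 2%N.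
Proof.
move=> pi_irr; have [z] : exists z, root pi z.
  by apply/closed_rootP; rewrite neq_ltn pi_irr.1 orbT.
rewrite -dvdp_XsubCl => /(irredp_size_eqp pi_irr).
by rewrite size_XsubC => /(_ isT)/eqp_size->; rewrite size_XsubC.
Qed.

Lemma small_mult_count s :
  small_mult (prodX s) <-> forall z, (count_mem z s <= 2)%N.
Proof.
have prod_neq0 : prodX s != 0 by rewrite -size_poly_gt0 size_prodX.
split=> [sm_s z|cnt pi m pi_irr pim].
  rewrite -mu_prod_XsubC -ltnS mup_ltn //; apply/negP.
  by move/(sm_s _ _ (irredp_XsubC z)); rewrite size_exp_XsubC.
have sz := irredp_closed_size2 pi_irr.
have -> : size (pi ^+ m) = m.+1.
  by rewrite polySpred ?expf_neq0 ?irredp_neq0 // size_exp sz mul1n.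
have [z] : exists z, root pi z by apply/closed_rootP; rewrite sz.
rewrite -dvdp_XsubCl => z_pi; rewrite ltnS; apply: leq_trans (cnt z).
rewrite -mu_prod_XsubC mup_geq //; apply: dvdp_trans pim.
exact: dvdp_exp2r.
Qed.

Lemma simple_or_double_rootsE (p : {poly C}) : p \is monic ->
  simple_or_double_roots p <-> small_mult p.
Proof.
move=> p_m; have [s def_p] := monic_prodX p_m; rewrite def_p.
rewrite small_mult_count; split=> [sd z|cnt z pz].
  have [zs|/count_memPn->//] := boolP (z \in s).
  by have := sd z; rewrite root_prod_XsubC mu_prod_XsubC => /(_ zs)[]->.
have := cnt z; rewrite mu_prod_XsubC.
have : (0 < count_mem z s)%N by rewrite -has_count has_pred1 -root_prod_XsubC.
by case: count => [|[|[|]]] //; [left | right].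
Qed.

(** Every copy of a root [z] of the nearby matrix is matched with a root of [A] near [z]; by
    separation these are all one root [y], so the multiplicity of [z] is at most that of [y]. *)
Lemma near_small_mult_complex n (A : 'M[C]_n) : small_mult (char_poly A) ->
  \forall B \near A, small_mult (char_poly B).
Proof.
have [t charA] := monic_prodX (char_poly_monic A).
rewrite charA small_mult_count => cnt_t.
have [e e_gt0 sep] := roots_separation t.
have e2_gt0 : 0 < e / 2%:R by rewrite divr_gt0.
apply: filterS (near_roots e2_gt0 charA) => B close.
have [s charB] := monic_prodX (char_poly_monic B).
rewrite charB small_mult_count => z; have [s' perm_s' close_s'] := close s charB.
rewrite -(seq.permP perm_s').
have close_z x y : `|x - y| < e / 2%:R -> pred1 z x -> `|y - z| < e / 2%:R.
  by move=> xy /eqP<-; rewrite distrC.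
apply: leq_trans (count_all2 close_z close_s') _.
have [|] := boolP (has (fun y => `|y - z| < e / 2%:R) t); last first.
  by rewrite has_count -eqn0Ngt => /eqP->.
case/hasP=> y yt y_z; apply: leq_trans (cnt_t y).
apply: (cluster (e := e / 2%:R)) => // [x x' xt x't|x x_z].
  by rewrite -splitr; apply: sep.
rewrite -(subrK z x) -addrA (le_lt_trans (ler_normD _ _)) // ltrD //.
by rewrite distrC.
Qed.

End ComplexSmallMult.

(** * Openness of (P) over the reals, through complex roots *)

Section RealSmallMult.

Variable R : realType.
Local Notation C := R[i].
Implicit Types (z : C) (s t : seq C) (p pi : {poly R}).

Local Notation prodX s := (\prod_(x <- s) ('X - x%:P)).
Local Notation toC := (map_poly (real_complex R)).

Definition real_quadratic z : {poly R} :=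
  'X^2 - (complex.Re z *+ 2)%:P * 'X + (complex.Re z ^+ 2 + complex.Im z ^+ 2)%:P.

Lemma toC_real_quadratic z :
  toC (real_quadratic z) = ('X - z%:P) * ('X - (conjc z)%:P).
Proof.
have -> : toC (real_quadratic z) = 'X^2 - (z + conjc z)%:P * 'X + (z * conjc z)%:P.
  rewrite /real_quadratic rmorphD rmorphB !rmorphM /= map_polyX !map_polyC -expr2 -polyCM.
  congr (_ - _%:P * _ + _%:P).
    by case: z => a b; apply/eqP; rewrite eq_complex /= subrr mulr2n !eqxx.
  case: z => a b; apply/eqP; rewrite eq_complex /= !expr2 mulrN opprK eqxx /=.
  by rewrite mulrN mulrC addNr.
rewrite !polyCD !polyCM; ring.
Qed.

Lemma size_real_quadratic z : size (real_quadratic z) = 3%N.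
Proof.
rewrite -(size_map_poly (real_complex R)) toC_real_quadratic.
by rewrite size_mul ?polyXsubC_eq0 // !size_XsubC.
Qed.

Lemma real_quadratic_irr z : conjc z != z -> irreducible_poly (real_quadratic z).
Proof.
move=> z_nonreal; apply: cubic_irreducible; first by rewrite size_real_quadratic.
move=> x; rewrite rootE.
have -> : (real_quadratic z).[x] = (x - complex.Re z) ^+ 2 + complex.Im z ^+ 2.
  by rewrite /real_quadratic !hornerE /=; ring.
have b_neq0 : complex.Im z != 0.
  apply: contra_neq z_nonreal; case: z => a b /= ->.
  by apply/eqP; rewrite eq_complex /= oppr0 !eqxx.
by rewrite gt_eqF // ltr_wpDl ?sqr_ge0 // exprn_even_gt0.
Qed.

(** Coprimality over the reals persists over the complex numbers and would exclude a common root. *)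
Lemma irredp_common_root (pi p : {poly R}) z : irreducible_poly pi ->
  root (toC pi) z -> root (toC p) z -> pi %| p.
Proof.
move=> pi_irr pi_z p_z; apply: contraLR pi_z => pi'p.
have cop : coprimep (toC pi) (toC p).
  by rewrite coprimep_map irredp_dvd_coprime.
by apply/negP => pi_z; have := coprimep_root cop pi_z; rewrite (eqP p_z) eqxx.
Qed.

Lemma conjc_fixed z : conjc z = z -> z = real_complex R (complex.Re z).
Proof.
case: z => a b /= [] /eqP; rewrite eq_sym -addr_eq0 -mulr2n mulrn_eq0 /=.
by move=> /eqP->.
Qed.

Lemma irredp_real_root pi z : irreducible_poly pi -> root (toC pi) z ->
    if conjc z == z then size pi = 2%N else pi %= real_quadratic z.
Proof.
move=> pi_irr pi_z; case: eqP => [z_real | /eqP z_nonreal].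
  have def_z := conjc_fixed z_real.
  have : ('X - (complex.Re z)%:P) %| pi.
    by rewrite dvdp_XsubCl; move: pi_z; rewrite {1}def_z fmorph_root.
  move/(irredp_size_eqp pi_irr); rewrite size_XsubC => /(_ isT)/eqp_size->.
  by rewrite size_XsubC.
apply: irredp_eqp_dvd => //; first exact: real_quadratic_irr.
apply: irredp_common_root pi_irr pi_z _.
by rewrite toC_real_quadratic rootM root_XsubC eqxx.
Qed.

Lemma toC_root pi : (1 < size pi)%N -> exists z, root (toC pi) z.
Proof.
move=> pi_gt1; apply/closed_rootP; rewrite size_map_poly.
by rewrite neq_ltn pi_gt1 orbT.
Qed.

Lemma irredp_real_le3 pi : irreducible_poly pi -> (size pi <= 3)%N.
Proof.
move=> pi_irr; have [z /(irredp_real_root pi_irr)] := toC_root pi_irr.1.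
by case: eqP => _ => [-> // | /eqp_size->]; rewrite size_real_quadratic.
Qed.

(** A real root comes from a linear factor, whose square is allowed; a nonreal one from a quadratic
    factor, which already exhausts degree 2. *)
Lemma real_small_mult_count p s : toC p = prodX s ->
  small_mult p <->
  forall z, (count_mem z s <= if conjc z == z then 2 else 1)%N.
Proof.
move=> def_p; have prod_neq0 : prodX s != 0 by rewrite -size_poly_gt0 size_prodX.
split=> [sm_p z|cnt pi m pi_irr pim].
  rewrite -mu_prod_XsubC -ltnS mup_ltn //; apply/negP; rewrite -def_p.
  case: eqP => [z_real | /eqP z_nonreal] zp.
    have def_z := conjc_fixed z_real.
    have : ('X - (complex.Re z)%:P) ^+ 3 %| p.
      rewrite -(dvdp_map (real_complex R)) rmorphXn /= rmorphB /= map_polyX.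
      by rewrite map_polyC -[X in 'X - X%:P]def_z.
    by move/(sm_p _ _ (irredp_XsubC _)); rewrite size_exp_XsubC.
  have q_irr := real_quadratic_irr z_nonreal.
  have qz : root (toC (real_quadratic z)) z.
    by rewrite toC_real_quadratic rootM root_XsubC eqxx.
  have pz : root (toC p) z.
    by rewrite -dvdp_XsubCl; apply: dvdp_trans zp; rewrite expr2 dvdp_mulr.
  have /dvdpP[r def_r] := irredp_common_root q_irr qz pz.
  (* Cancelling one ['X - z%:P] leaves the conjugate factor, which does not vanish at [z]; so the
     second copy of [z] is a root of [r]. *)
  have rz : root (toC r) z.
    move: zp; rewrite def_r rmorphM /= toC_real_quadratic mulrCA expr2.
    rewrite dvdp_mul2l ?polyXsubC_eq0 // dvdp_XsubCl rootM root_XsubC.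
    by rewrite eq_sym (negPf z_nonreal) orbF.
  have q2 : real_quadratic z ^+ 2 %| p.
    by rewrite def_r expr2 dvdp_mul2r ?irredp_neq0 // (irredp_common_root q_irr qz rz).
  have := sm_p _ _ q_irr q2.
  by rewrite expr2 size_mul ?irredp_neq0 // !size_real_quadratic.
have [z pi_z] := toC_root pi_irr.1.
have := irredp_real_root pi_irr pi_z.
have m_le : (m <= count_mem z s)%N.
  rewrite -mu_prod_XsubC mup_geq // -def_p.
  apply: (@dvdp_trans _ (toC (pi ^+ m))); last by rewrite dvdp_map.
  by rewrite rmorphXn /= dvdp_exp2r // dvdp_XsubCl.
have := leq_trans m_le (cnt z); case: eqP => [_ m_le2 s2|_ m_le1 pi_q].
  have := size_exp pi m; rewrite s2 mul1n => sz.
  by case: (size (pi ^+ m)) sz => //= k ->; rewrite ltnS.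
case: m m_le1 {pim m_le} => [|[|m]] // _; first by rewrite expr0 size_poly1.
by rewrite expr1 (eqp_size pi_q) size_real_quadratic.
Qed.

Lemma count_conj p s z : toC p = prodX s -> count_mem (conjc z) s = count_mem z s.
Proof.
move=> def_p; have prod_neq0 : prodX s != 0 by rewrite -size_poly_gt0 size_prodX.
have le_conj w : (count_mem w s <= count_mem (conjc w) s)%N.
  rewrite -[in leqRHS]mu_prod_XsubC mup_geq // -def_p.
  have : ('X - w%:P) ^+ (count_mem w s) %| toC p.
    by rewrite def_p -mup_geq // mu_prod_XsubC.
  rewrite -(dvdp_map (@conjc R)) rmorphXn /= rmorphB /= map_polyX map_polyC /=.
  rewrite -map_poly_comp; congr (_ %| _); apply: eq_map_poly => x /=.
  by rewrite oppr0.
by apply/anti_leq; rewrite le_conj andbT -[in leqRHS](conjcK z).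
Qed.

Lemma near_small_mult_real n (A : 'M[R]_n) : small_mult (char_poly A) ->
  \forall B \near A, small_mult (char_poly B).
Proof.
have toC_monic (p : {poly R}) : p \is monic -> toC p \is monic.
  by rewrite map_monic.
have [t charA] := monic_prodX (toC_monic _ (char_poly_monic A)).
rewrite (real_small_mult_count charA) => cnt_t.
have [e0 e0_gt0 sep] := roots_separation t.
pose e := e0 / 2%:R; have e_gt0 : 0 < e by rewrite divr_gt0.
have {}sep x y : x \in t -> y \in t -> `|x - y| < e + e -> x = y.
  by rewrite -splitr; apply: sep.
have [d d_gt0 close] := roots_close t e_gt0.
(* [d] is a complex number, but positivity in [R[i]] forces it to be real, so it can bound real
   coefficients. *)
have dE : d = real_complex R (complex.Re d) by rewrite RRe_real // gtr0_real.
have Red_gt0 : 0 < complex.Re d by rewrite -ltcR -dE.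
apply: filterS (near_char_poly A Red_gt0) => B near_B.
have [s charB] := monic_prodX (toC_monic _ (char_poly_monic B)).
have [||s' perm_s' close_s'] := close s.
- apply: succn_inj; rewrite -!size_prodX -charA -charB.
  by rewrite !size_map_poly !size_char_poly.
- move=> k; rewrite -charA -charB !coef_map /= -rmorphB /= dE ltW //.
  by rewrite normc_def /= expr0n addr0 sqrtr_sqr ltcR near_B.
have cnt2 y : (count_mem y t <= 2)%N.
  by apply: leq_trans (cnt_t y) _; case: eqP.
pose around (a : pred C) : pred C := fun y => `[< exists2 x, a x & `|x - y| < e >].
have near_count (a : pred C) : (count a s <= count (around a) t)%N.
  rewrite -(seq.permP perm_s'); apply: count_all2 close_s' => x y xy ax.
  by apply/asboolP; exists x.
have le_norm z x y : `|z - x| < e -> `|z - y| < e -> `|x - y| < e + e.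
  move=> zx zy; rewrite -(subrK z x) -addrA (le_lt_trans (ler_normD _ _)) //.
  by rewrite ltrD // distrC.
apply/(real_small_mult_count charB) => z.
have [cnt0|cnt_gt0] := posnP (count_mem z s); first by rewrite cnt0; case: eqP.
have le_near := near_count (pred1 z).
have /hasP[y yt /asboolP[_ /eqP-> zy]] :
    has (around (pred1 z)) t.
  by rewrite has_count (leq_trans cnt_gt0).
have le_y : (count_mem z s <= count_mem y t)%N.
  apply: leq_trans le_near _; apply: (cluster sep yt) => x /asboolP[_ /eqP-> zx].
  exact: le_norm zx zy.
case: eqP => [_ | /eqP z_nonreal]; first exact: leq_trans (cnt2 y).
rewrite leqNgt; apply/negP => cnt_gt1.
(* A nonreal [y] has multiplicity at most 1 in [t], too little to absorb two copies of [z]. *)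
have y_real : conjc y = y.
  apply/eqP; apply: contraTT cnt_gt1 => /negPf y_nonreal; rewrite -leqNgt.
  by apply: leq_trans le_y _; have := cnt_t y; rewrite y_nonreal.
have zy' : `|conjc z - y| < e by rewrite -y_real -rmorphB /= normcJ.
(* [z] and its conjugate are distinct, each at least double, and both near the real point [y], whose
   multiplicity in [t] is at most 2. *)
have count4 : (4 <= count (predU (pred1 z) (pred1 (conjc z))) s)%N.
  have := count_predUI (pred1 z) (pred1 (conjc z)) s.
  rewrite (@eq_count _ (predI _ _) pred0) => [|x /=]; last first.
    by apply/negP => /andP[/eqP-> ]; rewrite eq_sym (negPf z_nonreal).
  rewrite count_pred0 addn0 => ->; rewrite (count_conj _ charB).
  exact: (leq_add cnt_gt1 cnt_gt1).
suff le2 : (count (around (predU (pred1 z) (pred1 (conjc z)))) t <= 2)%N.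
  by have := leq_trans (leq_trans count4 (near_count _)) le2.
apply: leq_trans (cnt2 y); apply: (cluster sep yt) => x.
by move=> /asboolP[w /orP[] /eqP-> wx]; [apply: le_norm wx zy | apply: le_norm wx zy'].
Qed.

End RealSmallMult.

(** * The interior of the X-formable matrices, and the theorem *)

Section Interior.

Variable K : numFieldType.

Lemma verifiesP_char_poly n (A : 'M[K]_n) :
  verifiesP (char_poly A) <-> small_mult (char_poly A).
Proof.
split; first exact: verifiesP_small_mult.
exact: small_mult_verifiesP (char_poly_monic A).
Qed.

Lemma interior_xformable n :
    (forall A : 'M[K]_n, small_mult (char_poly A) ->
       \forall B \near A, small_mult (char_poly B)) ->
  interior [set A : 'M[K]_n | xformable A] = [set A | verifiesP (char_poly A)].
Proof.
move=> near_sm; apply/seteqP; split=> A /=; rewrite verifiesP_char_poly.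
  exact: interior_small_mult.
move/near_sm; apply: filterS => B; exact: small_mult_xformable.
Qed.

End Interior.

Theorem theorem1p3 (R : realType) (n : nat) (hn : (1 <= n)%N) :
  let F : set 'M[R[i]]_n := [set A | xformable A] in
  let G : set 'M[R]_n := [set A | xformable A] in
  [/\ dense F,
      interior F = [set A | verifiesP (char_poly A)]
        /\ [set A : 'M[R[i]]_n | verifiesP (char_poly A)] =
           [set A | simple_or_double_roots (char_poly A)],
      dense G &
      interior G = [set A | verifiesP (char_poly A)]].
Proof.
move=> F G; split.
- by apply: (@dense_xformable R[i] n hn) => pi /irredp_closed_size2 ->.
- split; first exact: (@interior_xformable R[i] n (@near_small_mult_complex R n)).
  apply/seteqP; split=> A /=; rewrite (simple_or_double_rootsE (char_poly_monic A));
    by rewrite (@verifiesP_char_poly R[i]).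
- exact: (@dense_xformable R n hn (@irredp_real_le3 R)).
- exact: (@interior_xformable R n (@near_small_mult_real R n)).
Qed.
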